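(* Let $d>0$, $d\in\mathbb{Q}$, $\sqrt d\notin\mathbb{Q}$. Let $A,B$ be trapezoids of height $1$, all of whose bases are parallel to one fixed line, each having both angles at its larger base equal to $45^\circ$, with midlines of lengths $a,b\in\mathbb{Q}[\sqrt d]$ respectively, where $1<\overline a<a$. Suppose that $B$ can be trivially tiled by trapezoids homothetic to $A$. Then $b$ satisfies the following conditions: (i) $1<\overline b<b$; (ii) $\overline b/b\ \ge\ \overline a/a$; (iii) $\ln G(b)/\ln\overline{G(b)}\ \ge\ \ln G(a)/\ln\overline{G(a)}$, where $G(x)=(x-1)/(x+1)$.
   Context: $\mathbb{Q}[\sqrt d]$ is the set of real numbers $u+v\sqrt d$ with $u,v\in\mathbb{Q}$; for $x=u+v\sqrt d$ with $u,v\in\mathbb{Q}$, the conjugate is $\overline x=u-v\sqrt d$ (so $\overline{G(x)}=G(\overline x)$). A trapezoid is a quadrilateral with exactly one pair of parallel sides; these are its bases, and its midline has length equal to half the sum of the lengths of the bases. A figure is homothetic to $A$ if it is its image under a map $z\mapsto \lambda z+w$ of the plane with real $\lambda\neq 0$ (negative $\lambda$ allowed) and $w\in\mathbb{R}^2$. A tiling of a figure is a representation of it as a finite union of figures (tiles) with pairwise disjoint interiors. Trivial tilings are defined recursively: a tiling of a plane figure is trivial if either (1) it consists of the figure itself only, or (2) there is a segment that runs only along boundaries of tiles and divides the figure into two figures, each of which is trivially tiled (by the tiles it contains). *)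

(* Defs.v *)
From HB Require Import structures.
From mathcomp Require Import all_boot all_order all_algebra.
From mathcomp Require Import all_classical all_reals all_analysis.

Set Implicit Arguments.
Unset Strict Implicit.
Unset Printing Implicit Defensive.

Import Order.TTheory GRing.Theory Num.Theory.
Import numFieldNormedType.Exports.

Local Open Scope classical_set_scope.
Local Open Scope ring_scope.

Definition Qsqrt (R : realType) (d : rat) : set R :=
  [set x | exists u v : rat, x = ratr u + ratr v * Num.sqrt (ratr d)].

(* Meaningful on Qsqrt d when Num.sqrt (ratr d) is irrational, the pair
   (u, v) being then unique; 0 outside Qsqrt d. *)
Definition qconj (R : realType) (d : rat) (x : R) : R :=
  xget 0 [set y | exists u v : rat,
    x = ratr u + ratr v * Num.sqrt (ratr d) /\
    y = ratr u - ratr v * Num.sqrt (ratr d)].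

Definition G (R : realType) (x : R) : R := (x - 1) / (x + 1).

(* R^o makes the plane a normed module over R. Its canonical norm `|z| is the
   sup norm, used here only through the topology it induces; lengths are
   measured by the Euclidean norm enorm. *)
Notation plane R := (R^o * R^o)%type.

Section PlaneGeometry.
Variable R : realType.
Implicit Types (e p q r s u v z w : plane R) (A F : set (plane R)).

Definition dot u v : R := u.1 * v.1 + u.2 * v.2.
Definition cross u v : R := u.1 * v.2 - u.2 * v.1.
Definition enorm u : R := Num.sqrt (dot u u).

Definition parallel u v : Prop := cross u v = 0.

(* the angle at the vertex q *)
Definition angle p q r : R :=
  acos (dot (p - q) (r - q) / (enorm (p - q) * enorm (r - q))).

Definition segment p q : set (plane R) :=
  [set (1 - t) *: p + t *: q | t in [set t : R | 0 <= t <= 1]].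

Definition line p q : set (plane R) :=
  [set (1 - t) *: p + t *: q | t in [set: R]].

Definition quadrilateral p q r s : set (plane R) :=
  smallest (@convex_set R (plane R)) [set p; q; r; s].

(* p, q, r, s are, in counterclockwise order, the vertices of a convex
   quadrilateral: the boundary path makes a strict left turn at every vertex. *)
Definition convex_ccw p q r s : Prop :=
  [/\ 0 < cross (q - p) (r - q), 0 < cross (r - q) (s - r),
      0 < cross (s - r) (p - s) & 0 < cross (p - s) (q - p)].

(* The bases are pq and rs. A quadrilateral with a pair of parallel sides is
   convex, so that convex_ccw only fixes the order of the vertices. *)
Definition trapezoid p q r s : Prop :=
  [/\ convex_ccw p q r s, parallel (q - p) (s - r) &
      ~ parallel (r - q) (p - s)].

(* distance between the lines supporting the bases pq and rs *)
Definition height p q r s : R :=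
  inf [set enorm (x - y) | x in line p q & y in line r s].

Definition midline p q r s : R := (enorm (q - p) + enorm (s - r)) / 2.

(* F is a trapezoid of height 1 and midline m with bases parallel to e and
   angles of 45 degrees at its larger base, which is labelled pq. *)
Definition trapezoid45 e (m : R) F : Prop :=
  exists p q r s,
    [/\ trapezoid p q r s, F = quadrilateral p q r s & parallel (q - p) e] /\
    [/\ enorm (s - r) < enorm (q - p),
        angle s p q = pi / 4, angle p q r = pi / 4,
        height p q r s = 1 & midline p q r s = m].

Definition homothetic A F : Prop :=
  exists (l : R) w, l != 0 /\ F = [set l *: z + w | z in A].

Definition figure F : Prop :=
  [/\ F !=set0, compact F & closure (interior F) = F].

Definition boundary F : set (plane R) := closure F `\` interior F.

Definition tiling F (T : set (set (plane R))) : Prop :=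
  [/\ finite_set T, (forall t, T t -> figure t), F = \bigcup_(t in T) t &
      trivIset T (@interior (plane R))].

(* the segment S divides the figure F into the figures F1 and F2 *)
Definition divides (S : set (plane R)) F F1 F2 : Prop :=
  [/\ figure F1, figure F2, F1 `|` F2 = F & F1 `&` F2 = S].

Inductive trivial_tiling : set (plane R) -> set (set (plane R)) -> Prop :=
| trivial_tiling_self F : figure F -> trivial_tiling F [set F]
| trivial_tiling_cut F T p q F1 F2 :
    tiling F T ->
    p != q ->
    segment p q `<=` \bigcup_(t in T) boundary t ->
    divides (segment p q) F F1 F2 ->
    trivial_tiling F1 [set t | T t /\ t `<=` F1] ->
    trivial_tiling F2 [set t | T t /\ t `<=` F2] ->
    trivial_tiling F T.

End PlaneGeometry.

(* Main.v *)
Require Import Defs.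
From HB Require Import structures.
From mathcomp Require Import all_boot all_order all_algebra.
From mathcomp Require Import all_classical all_reals all_analysis.
From mathcomp Require Import ring lra.

Set Implicit Arguments.
Unset Strict Implicit.
Unset Printing Implicit Defensive.

Import Order.TTheory GRing.Theory Num.Theory.
Import numFieldNormedType.Exports.

Local Open Scope classical_set_scope.
Local Open Scope ring_scope.

(** Trivially tiled trapezoids.

The key is that only few shapes occur. Every cut runs along sides of tiles, so
it is parallel to a leg or to the bases (cut_direction), and cutting a convex
figure produces its two intersections with half-planes (divides_halfplanes).
Starting from the trapezoid B, such cuts could produce triangles, trapezoids
with slanted bases, pentagons and hexagons. But a triangle, or a triangle
truncated parallel to a slanted side, always leaves a shape of the same kind
after a cut, and is never a tile, so it cannot be tiled
(guillotine_not_corner). A cut of a tiled trapezoid or parallelogram that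
avoids such pieces yields only trapezoids and parallelograms whose bases keep
the fixed direction.

Attach to each shape the ratio of its midline (or width) to its height. A cut
of a parallelogram adds the ratios or adds their inverses; a cut parallel to a
leg of a trapezoid adds the ratios of a parallelogram and a trapezoid; a cut
parallel to the bases of a trapezoid multiplies the values of G, which is the
quotient of the smaller base by the larger one. Equivalently it adds the values
of acoth2 = - ln G. All these operations are rational and commute with
conjugation. Let a' be the conjugate of a, rho = a' / a and
kappa = ln G(a) / ln G(a'). By induction on the tiling
(guillotine_trap_ratio), every parallelogram ratio x with conjugate x'
satisfies 0 < x' < x and x' >= rho x, and every trapezoid ratio satisfies
moreover 1 < x' and acoth2 x >= kappa acoth2 x'. For B these are the claims.

The one delicate point is that the last inequality survives the addition of a
parallelogram (trap_invD). This uses kappa <= rho, that is, the monotonicity of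
x acoth2 x (acoth2_scale_le), and the fact that raising the arguments x and x'
of the inequality by p and kappa p preserves it (acoth2_shift_le). *)

(** * The function - ln G *)

Section HyperbolicCotangent.
Variable R : realType.
Implicit Types (x y s c m p : R).

(** This is 2 arcoth x, and it equals - ln (G x) for 1 < x; it turns the
multiplicativity of G under horizontal cuts into additivity. *)
Definition acoth2 x : R := ln (x + 1) - ln (x - 1).

Lemma lnGE x : 1 < x -> ln (G x) = - acoth2 x.
Proof.
move=> x1; rewrite /G ln_div ?posrE /acoth2; first by ring.
  by lra.
by lra.
Qed.

Lemma acoth2_gt0 x : 1 < x -> 0 < acoth2 x.
Proof.
move=> x1; rewrite /acoth2 subr_gt0 ltr_ln ?posrE; lra.
Qed.

Lemma acoth2_nincr x y : 1 < x -> x <= y -> acoth2 y <= acoth2 x.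
Proof.
move=> x1 xy; rewrite /acoth2 -!ln_div ?posrE; try lra.
rewrite ler_ln ?posrE; [|apply: divr_gt0; lra|apply: divr_gt0; lra].
rewrite ler_pdivrMr; last by lra.
rewrite mulrAC ler_pdivlMr; last by lra.
lra.
Qed.

Lemma acoth2_le x : 1 < x -> acoth2 x <= 2 / (x - 1).
Proof.
move=> x1; rewrite /acoth2 -ln_div ?posrE; [|lra|lra].
have -> : (x + 1) / (x - 1) = 1 + 2 / (x - 1) by field; lra.
apply: le_ln1Dx.
apply: lt_trans (_ : 0 < _); first by lra.
by apply: divr_gt0; lra.
Qed.

(** The addition theorem of the hyperbolic cotangent, equivalent to
G ((1 + x y) / (x + y)) = G x * G y. *)
Lemma acoth2D x y : 1 < x -> 1 < y ->
  acoth2 ((1 + x * y) / (x + y)) = acoth2 x + acoth2 y.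
Proof.
move=> x1 y1; rewrite /acoth2.
have xy0 : x + y != 0 by lra.
have -> : (1 + x * y) / (x + y) + 1 = (x + 1) * (y + 1) / (x + y) by field.
have -> : (1 + x * y) / (x + y) - 1 = (x - 1) * (y - 1) / (x + y) by field.
have p1 : 0 < (x + 1) * (y + 1) by apply: mulr_gt0; lra.
have p2 : 0 < (x - 1) * (y - 1) by apply: mulr_gt0; lra.
rewrite !ln_div ?posrE ?lnM ?posrE //; try lra.
Qed.

(** The derivative of x |-> acoth2 x - c acoth2 (c x + m) has the sign of
c^2 (x^2 - 1) - ((c x + m)^2 - 1), in which the quadratic terms cancel: an
affine function of x, which changes sign at most once. *)
Lemma acoth2_affine_MVT c m x y : 1 < x -> x < y -> 0 <= c ->
  1 < c * x + m ->
  exists2 z, x < z < y & exists2 k, 0 <= k &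
    (acoth2 y - c * acoth2 (c * y + m)) - (acoth2 x - c * acoth2 (c * x + m)) =
    k * (1 - c ^+ 2 - m ^+ 2 - 2 * c * m * z).
Proof.
move=> x1 xy c0 u1.
pose f z := acoth2 z - c * acoth2 (c * z + m).
pose df z := ((z + 1)^-1 - (z - 1)^-1)
  - c * (c * (c * z + m + 1)^-1 - c * (c * z + m - 1)^-1).
have dlin (k a z : R) : is_derive z 1 (fun t : R => k * t + a) k.
  have H := is_deriveD (is_deriveZ k (is_derive_id z 1)) (is_derive_cst a z 1).
  by apply: (is_derive_eq H); rewrite addr0 [LHS]mulr1.
have dln (k a z : R) : 0 < k * z + a ->
    is_derive z 1 (fun t : R => ln (k * t + a)) (k * (k * z + a)^-1).
  move=> ka; have H1 := is_derive1_ln ka; have H2 := dlin k a z.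
  have H := @is_derive1_comp _ (@ln R) (fun t : R => k * t + a) z _ _ H1 H2.
  by apply: (is_derive_eq H); rewrite mulrC.
have mono z : x <= z -> c * x + m <= c * z + m.
  by move=> xz; rewrite lerD2r ler_wpM2l.
have dfP z : x <= z -> is_derive z 1 f (df z).
  move=> xz; have uz := mono _ xz.
  have -> : f = (fun t => (ln (1 * t + 1) - ln (1 * t + -1)) -
     c * (ln (c * t + (m + 1)) - ln (c * t + (m - 1)))).
    by apply/funext => t; rewrite /f /acoth2 !mul1r !addrA.
  have d1 : 0 < 1 * z + 1 by lra.
  have d2 : 0 < 1 * z + -1 by lra.
  have d3 : 0 < c * z + (m + 1) by lra.
  have d4 : 0 < c * z + (m - 1) by lra.
  have H := is_deriveB (is_deriveB (dln _ _ _ d1) (dln _ _ _ d2))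
    (is_deriveZ c (is_deriveB (dln _ _ _ d3) (dln _ _ _ d4))).
  by apply: (is_derive_eq H); rewrite /df !mul1r !addrA.
have dfoo z : z \in `]x, y[%R -> is_derive z 1 f (df z).
  by rewrite in_itv/= => /andP[xz _]; apply: dfP; exact: ltW.
have cf : {within `[x, y], continuous f}.
  apply: derivable_within_continuous => z; rewrite in_itv/= => /andP[xz _].
  exact: (@ex_derive _ _ _ _ _ _ _ (dfP z xz)).
have [z zxy E] := MVT xy dfoo cf.
move: zxy; rewrite in_itv/= => zxy; exists z => //.
have xz : x <= z by case/andP: zxy => /ltW.
have uz := mono _ xz.
have h1 : 0 < (c * z + m) ^+ 2 - 1 by rewrite subr_gt0 expr_gt1 //; lra.
have h2 : 0 < z ^+ 2 - 1 by rewrite subr_gt0 expr_gt1 //; lra.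
exists (2 / ((z ^+ 2 - 1) * ((c * z + m) ^+ 2 - 1)) * (y - x)).
  apply: mulr_ge0; last by lra.
  by apply: divr_ge0 => //; apply: mulr_ge0; exact: ltW.
rewrite -/(f y) -/(f x) E [RHS]mulrAC; congr (_ * _).
rewrite /df; field.
repeat (apply/andP; split); lra.
Qed.

(** For m = 0 the derivative above is nonnegative, so the difference
acoth2 x - c acoth2 (c x) increases to its limit 0 at infinity. In other words
x acoth2 x is nonincreasing. *)
Lemma acoth2_scale_le c x : 0 < c <= 1 -> 1 < c * x ->
  acoth2 x <= c * acoth2 (c * x).
Proof.
case/andP=> c0 c1 cx1.
have x1 : 1 < x.
  have x0 : 0 < x by rewrite -(pmulr_rgt0 x c0); lra.
  apply: lt_le_trans cx1 _; rewrite -[leRHS]mul1r; apply: ler_wpM2r => //.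
  exact: ltW.
suff H e : 0 < e -> acoth2 x <= c * acoth2 (c * x) + e.
  by apply/ler_addgt0Pr.
move=> e0; pose y := x + 2 / e.
have e2 : 0 < 2 / e by exact: divr_gt0.
have xy : x < y by rewrite /y; lra.
have cx1' : 1 < c * x + 0 by lra.
have [z _ [k k0]] := acoth2_affine_MVT x1 xy (ltW c0) cx1'.
rewrite !addr0 !mulr0 mul0r => E.
have D0 : 0 <= k * (1 - c ^+ 2 - 0 ^+ 2 - 0).
  apply: mulr_ge0 => //; rewrite expr0n /= !subr0 subr_ge0.
  by rewrite expr_le1 // ltW.
have y1 : 1 < y by lra.
have fy := acoth2_le y1.
have fy0 : 0 < acoth2 (c * y).
  apply: acoth2_gt0; apply: lt_le_trans cx1 _.
  by rewrite ler_wpM2l ?ltW.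
have fcy0 : 0 < c * acoth2 (c * y) by exact: mulr_gt0.
have ye : 2 / (y - 1) <= e.
  rewrite ler_pdivrMr; last by lra.
  have -> : e * (y - 1) = e * (x - 1) + 2.
    by rewrite /y; field; lra.
  rewrite lerDr; apply: mulr_ge0; lra.
lra.
Qed.

(** The inequality survives when s grows by p and y by c p: where the
derivative of the difference is nonnegative, compare with p = 0, and beyond the
sign change the difference decreases to its limit 0 at infinity. *)
Lemma acoth2_shift_le c s y p : 0 < c <= 1 -> 1 < s -> 1 < y -> 0 <= p ->
  c * acoth2 y <= acoth2 s -> c * acoth2 (y + c * p) <= acoth2 (s + p).
Proof.
case/andP=> c0 c1 s1 y1; rewrite le_eqVlt => /predU1P[<-|p0].
  by rewrite mulr0 !addr0.
move=> H; pose m := y - c * s.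
have yE : y = c * s + m by rewrite /m; ring.
have yE' : y + c * p = c * (s + p) + m by rewrite /m; ring.
have c21 : c ^+ 2 <= 1 by rewrite expr_le1 // ltW.
have cp : 0 < c * p by exact: mulr_gt0.
have ssp : s < s + p by lra.
have u1 : 1 < c * s + m by rewrite -yE.
have sp1 : 1 < s + p by lra.
have v1 : 1 < c * (s + p) + m by rewrite -yE'; lra.
pose D z := 1 - c ^+ 2 - m ^+ 2 - 2 * c * m * z.
have DE z : D z = c ^+ 2 * (z ^+ 2 - 1) - ((c * z + m) ^+ 2 - 1).
  by rewrite /D; ring.
have [Dge0|Dlt0] := leP 0 (D (s + p)).
  (* the difference is nondecreasing on [s, s + p] *)
  have [z /andP[sz zsp] [k k0]] := acoth2_affine_MVT s1 ssp (ltW c0) u1.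
  rewrite -/(D z) -yE -yE' => E.
  suff Dz : 0 <= D z by have := mulr_ge0 k0 Dz; lra.
  have [m0|m0] := leP 0 m.
    apply: le_trans Dge0 _; rewrite /D lerD2l lerN2.
    apply: ler_wpM2l; last exact: ltW.
    by apply: mulr_ge0 => //; lra.
  have csz : c * s < c * z by rewrite ltr_pM2l.
  have cz : 0 < c * z + m by lra.
  rewrite DE.
  have : (c * z + m) ^+ 2 <= (c * z) ^+ 2.
    by rewrite ler_sqr ?nnegrE; lra.
  by rewrite exprMn; lra.
(* the difference is nonincreasing on [s + p, +oo[ and tends to 0 *)
have m0 : 0 <= m.
  rewrite leNgt; apply/negP => m0; move: Dlt0; rewrite DE.
  have : (c * (s + p) + m) ^+ 2 <= (c * (s + p)) ^+ 2.
    by rewrite ler_sqr ?nnegrE; lra.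
  by rewrite exprMn; lra.
rewrite yE'; apply/ler_addgt0Pr => e e0.
have ce2 : 0 < 2 / (c * e) by apply: divr_gt0 => //; exact: mulr_gt0.
pose t := s + p + 2 / (c * e).
have spt : s + p < t by rewrite /t; lra.
have [z /andP[sz zsp] [k k0]] := acoth2_affine_MVT sp1 spt (ltW c0) v1.
rewrite -/(D z) => E.
have Dz : D z <= 0.
  apply: le_trans (ltW Dlt0); rewrite /D lerD2l lerN2.
  apply: ler_wpM2l; last exact: ltW.
  apply: mulr_ge0 => //; lra.
have := mulr_ge0_le0 k0 Dz; rewrite -E.
have t1 : 1 < t by lra.
have := acoth2_gt0 t1.
have w1 : 2 / e < c * t + m - 1.
  rewrite /t mulrDr.
  have -> : c * (2 / (c * e)) = 2 / e by field; lra.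
  lra.
have e2 : 0 < 2 / e by exact: divr_gt0.
have w2 : 1 < c * t + m by lra.
have w3 := acoth2_le w2.
have w4 := acoth2_gt0 w2.
have w5 : 2 / (c * t + m - 1) <= e.
  rewrite ler_pdivrMr; last by lra.
  move: w1; rewrite ltr_pdivrMr // => w1; lra.
have : c * acoth2 (c * t + m) <= acoth2 (c * t + m).
  by rewrite -[leRHS]mul1r ler_wpM2r // ltW.
lra.
Qed.

End HyperbolicCotangent.

(** * Conjugation in a real quadratic field *)

Section QuadraticConjugation.
Variables (R : realType) (d : rat).
Hypothesis d_gt0 : 0 < d.
Hypothesis sqrtd_irrational : forall q : rat, Num.sqrt (ratr d) <> ratr q :> R.
Implicit Types x y : R.

Let rd : R := Num.sqrt (ratr d).

(** Carries the witnesses of x in the quadratic field, so that closure under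
the field operations and the value of the conjugate are proved together. *)
Definition conjugates x y : Prop := exists u v : rat,
  x = ratr u + ratr v * Num.sqrt (ratr d) /\
  y = ratr u - ratr v * Num.sqrt (ratr d).

Let rd2 : rd * rd = ratr d.
Proof. by rewrite -expr2 sqr_sqrtr // ler0q ltW. Qed.

(** Irrationality of the square root makes 1 and it linearly independent over
the rationals. *)
Lemma rat_sqrt_eq0 (u v : rat) : ratr u + ratr v * rd = 0 -> u = 0 /\ v = 0.
Proof.
have [-> H|v0 H] := eqVneq v 0.
  by split=> //; move: H; rewrite rmorph0 mul0r addr0 => /eqP;
     rewrite fmorph_eq0 => /eqP.
case: (sqrtd_irrational (q := - u / v)).
rewrite rmorphM fmorphV rmorphN /= -/rd.
have v0' : (ratr v : R) != 0 by rewrite fmorph_eq0.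
apply: (mulfI v0'); rewrite mulrCA divff // mulr1.
by apply/eqP; rewrite -addr_eq0 addrC H.
Qed.

Lemma conjugates_qconj x y : conjugates x y -> qconj d x = y.
Proof.
move=> xy; rewrite /qconj; case: xgetP => [z _ /= [u' [v' [xE ->]]]|/(_ y)//].
case: xy => u [v [xE' ->]]; rewrite -/rd in xE xE' *.
have : ratr (u - u') + ratr (v - v') * rd = 0.
  rewrite !rmorphB /=; move/eqP: xE; rewrite xE' -subr_eq0 => /eqP <-; ring.
by move=> /rat_sqrt_eq0[/eqP + /eqP]; rewrite !subr_eq0 => /eqP-> /eqP->.
Qed.

Lemma conjugates1 : conjugates 1 1.
Proof. by exists 1, 0; rewrite !rmorph0 !rmorph1 !mul0r addr0 subr0. Qed.

Lemma conjugatesD x x' y y' :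
  conjugates x x' -> conjugates y y' -> conjugates (x + y) (x' + y').
Proof.
move=> [u [v [-> ->]]] [w [z [-> ->]]]; exists (u + w), (v + z).
by rewrite !rmorphD /=; split; ring.
Qed.

Lemma conjugatesN x x' : conjugates x x' -> conjugates (- x) (- x').
Proof.
move=> [u [v [-> ->]]]; exists (- u), (- v).
by rewrite !rmorphN /=; split; ring.
Qed.

Lemma conjugatesM x x' y y' :
  conjugates x x' -> conjugates y y' -> conjugates (x * y) (x' * y').
Proof.
move=> [u [v [-> ->]]] [w [z [-> ->]]]; rewrite -?/rd.
exists (u * w + v * z * d), (u * z + v * w).
by rewrite -/rd !rmorphD /= !rmorphM /= -rd2; split; ring.
Qed.

(** The inverse of x is x' divided by the norm x x', a nonzero rational. *)
Lemma conjugatesV x x' : x != 0 -> conjugates x x' -> conjugates x^-1 x'^-1.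
Proof.
move=> x0 xx'; case: (xx') => u [v [xE x'E]]; rewrite -/rd in xE x'E *.
have x'0 : x' != 0.
  apply: contra_neq x0 => x'0; move: x'E; rewrite x'0 -mulNr -rmorphN.
  by move=> /esym/rat_sqrt_eq0[u0 /eqP]; rewrite oppr_eq0 => /eqP v0;
    rewrite xE u0 v0 rmorph0 mul0r addr0.
pose N := u * u - v * v * d.
have NE : ratr N = x * x' :> R.
  by rewrite /N rmorphB /= !rmorphM /= -rd2 xE x'E; ring.
have N0 : x * x' != 0 by rewrite mulf_neq0.
exists (u / N), (- v / N); rewrite !rmorphM /= !fmorphV rmorphN /= NE -/rd.
split.
  apply: (mulIf N0); rewrite mulrA mulVf // mul1r [LHS]x'E.
  by field; rewrite x0 x'0.
apply: (mulIf N0); rewrite mulrCA mulVf // mulr1 [LHS]xE.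
by field; rewrite x0 x'0.
Qed.

Lemma conjugates_div x x' y y' : y != 0 ->
  conjugates x x' -> conjugates y y' -> conjugates (x / y) (x' / y').
Proof. by move=> y0 cx cy; apply: conjugatesM => //; exact: conjugatesV. Qed.

Lemma conjugates_G x x' :
  x + 1 != 0 -> conjugates x x' -> conjugates (G x) (G x').
Proof.
move=> x1 cx; apply: conjugates_div => //.
  by apply: conjugatesD => //; apply: conjugatesN; exact: conjugates1.
by apply: conjugatesD => //; exact: conjugates1.
Qed.

(** * The invariants of ratios *)

Section Invariants.
Variables rho kappa : R.
Hypothesis rho_gt0 : 0 < rho.
Hypothesis rho_lt1 : rho < 1.
Hypothesis kappa_gt0 : 0 < kappa.
Hypothesis kappa_le_rho : kappa <= rho.

(** What is known of the ratio of width to height of a parallelogram occurring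
in the tiling; rho is the quotient of the conjugate of a by a. *)
Definition par_inv x : Prop :=
  exists x', [/\ conjugates x x', 0 < x', x' < x & rho * x <= x'].

(** What is known of the ratio of midline to height of a trapezoid occurring
in the tiling; kappa is acoth2 a divided by acoth2 of the conjugate of a. *)
Definition trap_inv x : Prop :=
  exists x', [/\ conjugates x x', 1 < x', x' < x &
    rho * x <= x' /\ kappa * acoth2 x' <= acoth2 x].

Lemma trap_inv_par x : trap_inv x -> par_inv x.
Proof. by case=> x' [cx x1 xx [rx _]]; exists x'; split => //; lra. Qed.

Lemma par_invD x y : par_inv x -> par_inv y -> par_inv (x + y).
Proof.
move=> [x' [cx x1 x2 x3]] [y' [cy y1 y2 y3]]; exists (x' + y').
by split; [exact: conjugatesD|lra|lra|lra].
Qed.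

(** Stacking two parallelograms of the same width adds the inverses of the
ratios. *)
Lemma par_inv_harmonic x y :
  par_inv x -> par_inv y -> par_inv (x * y / (x + y)).
Proof.
move=> [x' [cx x1 x2 x3]] [y' [cy y1 y2 y3]].
have D0 : 0 < x + y by lra.
have D0' : 0 < x' + y' by lra.
exists (x' * y' / (x' + y')); split.
- apply: conjugates_div; [lra|exact: conjugatesM|exact: conjugatesD].
- by rewrite divr_gt0 // mulr_gt0.
- rewrite ltr_pdivrMr // mulrAC ltr_pdivlMr //.
  have : 0 < x * x' * (y - y') by rewrite !mulr_gt0 //; lra.
  have : 0 < y * y' * (x - x') by rewrite !mulr_gt0 //; lra.
  lra.
- rewrite mulrA ler_pdivrMr // mulrAC ler_pdivlMr //.
  have : 0 <= x * x' * (y' - rho * y) by rewrite !mulr_ge0 //; lra.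
  have : 0 <= y * y' * (x' - rho * x) by rewrite !mulr_ge0 //; lra.
  lra.
Qed.

(** Gluing a parallelogram to a leg of a trapezoid adds the ratios. The last
condition survives by acoth2_shift_le: the conjugate grows by at least rho x,
hence by at least kappa x. *)
Lemma trap_invD x y : par_inv x -> trap_inv y -> trap_inv (x + y).
Proof.
move=> [x' [cx x1 x2 x3]] [y' [cy y1 y2 [y3 y4]]]; exists (x' + y').
split; [exact: conjugatesD|lra|lra|split; first by lra].
have k1 : 0 < kappa <= 1 by rewrite kappa_gt0 (le_trans kappa_le_rho) ?ltW.
have yy : 1 < y by lra.
have xx : 0 <= x by lra.
have := acoth2_shift_le k1 yy y1 xx y4.
rewrite (addrC y x); apply: le_trans; apply: ler_wpM2l; first exact: ltW.
have kx : 0 < kappa * x by apply: mulr_gt0; lra.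
have kx' : kappa * x <= x'.
  by apply: le_trans x3; apply: ler_wpM2r => //; lra.
by apply: acoth2_nincr; lra.
Qed.

(** Stacking two trapezoids multiplies the values of G. The condition on kappa
is then additive; the one on rho rests on the monotonicity of
(1 + x y) / (x + y) in each argument beyond 1. *)
Lemma trap_inv_coth x y :
  trap_inv x -> trap_inv y -> trap_inv ((1 + x * y) / (x + y)).
Proof.
move=> [x' [cx x1 x2 [x3 x4]]] [y' [cy y1 y2 [y3 y4]]].
have D0 : 0 < x + y by lra.
have D0' : 0 < x' + y' by lra.
exists ((1 + x' * y') / (x' + y')); split; last split.
- apply: conjugates_div; [lra| |exact: conjugatesD].
  by apply: conjugatesD; [exact: conjugates1|exact: conjugatesM].
- rewrite ltr_pdivlMr //.
  have : 0 < (x' - 1) * (y' - 1) by apply: mulr_gt0; lra.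
  lra.
- rewrite ltr_pdivrMr // mulrAC ltr_pdivlMr //.
  have : 0 < (x - x') * (y * y' - 1).
    by apply: mulr_gt0; [lra|rewrite subr_gt0; apply: mulr_egt1; lra].
  have : 0 < (y - y') * (x * x' - 1).
    by apply: mulr_gt0; [lra|rewrite subr_gt0; apply: mulr_egt1; lra].
  lra.
- rewrite mulrA ler_pdivrMr // mulrAC ler_pdivlMr //.
  have x'y'1 : 0 < (x' - 1) * (y' - 1) by apply: mulr_gt0; lra.
  have r1 := rho_lt1.
  (* when rho x <= 1 the new ratio is below x, hence below 1 / rho, while its
     conjugate exceeds 1 *)
  have [rx1|rx1] := leP (rho * x) 1.
    have : 0 < (x' - 1) * (y' - 1) * (x + y) by apply: mulr_gt0.
    have e0 : 0 <= x + y - rho * (1 + x * y).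
      have : 0 <= (1 - rho * x) * y by apply: mulr_ge0; lra.
      lra.
    have := mulr_ge0 e0 (ltW D0').
    lra.
  have [ry1|ry1] := leP (rho * y) 1.
    have : 0 < (x' - 1) * (y' - 1) * (x + y) by apply: mulr_gt0.
    have e0 : 0 <= x + y - rho * (1 + x * y).
      have : 0 <= (1 - rho * y) * x by apply: mulr_ge0; lra.
      lra.
    have := mulr_ge0 e0 (ltW D0').
    lra.
  have ex : 0 <= (x' - rho * x) * ((rho * y) * y' - 1).
    by apply: mulr_ge0; [lra|rewrite subr_ge0; apply: mulr_ege1; lra].
  have ey : 0 <= (y' - rho * y) * ((rho * x) * x' - 1).
    by apply: mulr_ge0; [lra|rewrite subr_ge0; apply: mulr_ege1; lra].
  have rho2 : 0 <= (1 - rho ^+ 2) * (x' + y').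
    by apply: mulr_ge0; [rewrite subr_ge0 expr_le1 // ltW|exact: ltW].
  rewrite -(ler_pM2l rho_gt0); lra.
- by rewrite !acoth2D //; lra.
Qed.

End Invariants.
End QuadraticConjugation.

(** * Guillotine tilings in three directions *)

(** Proves an equality between sets given by systems of linear inequalities. *)
Ltac halfplanes :=
  apply/seteqP; split => ? /=;
  repeat match goal with
    | |- (_ /\ _) -> _ => case
    | |- and3 _ _ _ -> _ => case
    | |- and4 _ _ _ _ -> _ => case
    | |- _ -> _ => intro
  end; repeat split; lra.

Section GuillotineTilings.
Variables (R : realFieldType) (T : Type) (L1 L2 : T -> R).
Hypothesis L_surj : forall x y, exists z, L1 z = x /\ L2 z = y.
Implicit Types (F : set T) (X Y f : T -> R).

(** L1 and L2 are constant along the two legs, and L1 + L2 is constant along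
the bases. The four frames are the symmetries that keep the direction of the
bases: exchange of the legs, and rotation by a half turn. *)
Inductive frame : (T -> R) -> (T -> R) -> Prop :=
| frame12 : frame L1 L2
| frame21 : frame L2 L1
| frameN12 : frame (fun z => - L1 z) (fun z => - L2 z)
| frameN21 : frame (fun z => - L2 z) (fun z => - L1 z).

Lemma frameC X Y : frame X Y -> frame Y X.
Proof. by case; constructor. Qed.

Lemma frameN X Y : frame X Y -> frame (fun z => - X z) (fun z => - Y z).
Proof.
have NN f : (fun z => - - f z) = f by apply/funext => z; rewrite opprK.
by case; rewrite ?NN; constructor.
Qed.

Lemma frame_surj X Y : frame X Y -> forall x y, exists z, X z = x /\ Y z = y.
Proof.
case=> x y.
- exact: L_surj.
- by have [z []] := L_surj y x; exists z.
- by have [z [z1 z2]] := L_surj (- x) (- y); exists z; rewrite z1 z2 !opprK.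
- by have [z [z1 z2]] := L_surj (- y) (- x); exists z; rewrite z1 z2 !opprK.
Qed.

Lemma frame_rel X Y X' Y' : frame X Y -> frame X' Y' ->
  [\/ (forall z, X' z = X z) /\ (forall z, Y' z = Y z),
      (forall z, X' z = Y z) /\ (forall z, Y' z = X z),
      (forall z, X' z = - X z) /\ (forall z, Y' z = - Y z) |
      (forall z, X' z = - Y z) /\ (forall z, Y' z = - X z)].
Proof.
by case; case; solve [apply: Or41; split=> z; rewrite ?opprK //
  | apply: Or42; split=> z; rewrite ?opprK //
  | apply: Or43; split=> z; rewrite ?opprK //
  | apply: Or44; split=> z; rewrite ?opprK //].
Qed.

(** The triangle a1 <= X, a2 <= Y, a3 <= - (X + Y) truncated parallel to its
third side. The quantity - (X + Y) is twice the height. *)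
Definition trap X Y (a1 a2 a3 b3 : R) : set T :=
  [set z | [/\ a1 <= X z, a2 <= Y z, a3 <= - (X z + Y z) & - (X z + Y z) <= b3]].

(** Midline over height: at level - (X + Y) = c the width is - a1 - a2 - c, and
the height is (b3 - a3) / 2. *)
Definition trap_ratio (a1 a2 a3 b3 : R) : R :=
  (- 2 * a1 - 2 * a2 - a3 - b3) / (b3 - a3).

Definition par X Y (a1 b1 a3 b3 : R) : set T :=
  [set z | [/\ a1 <= X z, X z <= b1, a3 <= - (X z + Y z) & - (X z + Y z) <= b3]].

(** Width over height. *)
Definition par_ratio (a1 b1 a3 b3 : R) : R := 2 * (b1 - a1) / (b3 - a3).

(** A triangle truncated parallel to the side X = a1, or a full triangle when
b1 is large: the shape that obstructs the tiling. *)
Definition corner X Y (a1 b1 a2 a3 : R) : set T :=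
  [set z | [/\ a1 <= X z, X z <= b1, a2 <= Y z & a3 <= - (X z + Y z)]].

Lemma trapC X Y a1 a2 a3 b3 : trap X Y a1 a2 a3 b3 = trap Y X a2 a1 a3 b3.
Proof. rewrite /trap; halfplanes. Qed.

Lemma trap_ratioC a1 a2 a3 b3 : trap_ratio a1 a2 a3 b3 = trap_ratio a2 a1 a3 b3.
Proof. by rewrite /trap_ratio; congr (_ / _); ring. Qed.

(** The order of the two pieces is left open, which makes the notion invariant
under f |-> - f. *)
Definition splits f F F1 F2 : Prop := exists c,
  [/\ exists2 z, F z & c < f z, exists2 z, F z & f z < c &
    (F1 = F `&` [set z | c <= f z] /\ F2 = F `&` [set z | f z <= c]) \/
    (F2 = F `&` [set z | c <= f z] /\ F1 = F `&` [set z | f z <= c])].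

(** A cut parallel to a leg or to the bases. *)
Definition cut F F1 F2 : Prop :=
  [\/ splits L1 F F1 F2, splits L2 F F1 F2 |
      splits (fun z => L1 z + L2 z) F F1 F2].

Inductive guillotine (a : R) : set T -> Prop :=
| guillotine_tile X Y a1 a2 a3 b3 :
    frame X Y -> a3 < b3 -> b3 < - a1 - a2 -> trap_ratio a1 a2 a3 b3 = a ->
    guillotine a (trap X Y a1 a2 a3 b3)
| guillotine_cut F F1 F2 :
    cut F F1 F2 -> guillotine a F1 -> guillotine a F2 -> guillotine a F.

Lemma splits_opp f F F1 F2 : splits f F F1 F2 -> splits (fun z => - f z) F F1 F2.
Proof.
move=> [c [[z Fz cz] [w Fw wc] H]]; exists (- c).
split; [by exists w => //; rewrite ltrN2|by exists z => //; rewrite ltrN2|].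
have E1 : [set z | - c <= - f z] = [set z | f z <= c].
  by apply/seteqP; split=> t /=; rewrite lerN2.
have E2 : [set z | - f z <= - c] = [set z | c <= f z].
  by apply/seteqP; split=> t /=; rewrite lerN2.
by rewrite E1 E2; case: H => -[-> ->]; [right|left].
Qed.

Lemma splits_both (P : set T -> Prop) f F F1 F2 :
  splits f F F1 F2 -> P F1 -> P F2 -> exists c,
  [/\ exists2 z, F z & c < f z, exists2 z, F z & f z < c,
      P (F `&` [set z | c <= f z]) & P (F `&` [set z | f z <= c])].
Proof. by move=> [c [z w [[-> ->]|[-> ->]]]] P1 P2; exists c; split. Qed.

Lemma cut_frame X Y F F1 F2 : frame X Y -> cut F F1 F2 ->
  [\/ splits X F F1 F2, splits Y F F1 F2 |
      splits (fun z => X z + Y z) F F1 F2].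
Proof.
have E2 : (fun z => L2 z + L1 z) = (fun z => L1 z + L2 z).
  by apply/funext => z; rewrite addrC.
have E3 : (fun z => - L1 z + - L2 z) = (fun z => - (L1 z + L2 z)).
  by apply/funext => z; ring.
have E4 : (fun z => - L2 z + - L1 z) = (fun z => - (L1 z + L2 z)).
  by apply/funext => z; ring.
case=> -[] H; rewrite ?E2 ?E3 ?E4; have H' := splits_opp H.
all: by [apply: Or31|apply: Or32|apply: Or33].
Qed.

(** The minimum of X over a trapezoid is attained along a whole leg, whose ends
lie on the two bases. *)
Lemma trap_flat X Y a1 a2 a3 b3 : frame X Y -> a3 < b3 -> b3 < - a1 - a2 ->
  exists z z', [/\ trap X Y a1 a2 a3 b3 z, trap X Y a1 a2 a3 b3 z',
    X z = a1 /\ X z' = a1, - (X z + Y z) = a3 /\ - (X z' + Y z') = b3 &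
    Y z <> Y z'].
Proof.
move=> fr ab ba; have [z [z1 z2]] := frame_surj fr a1 (- a3 - a1).
have [z' [z1' z2']] := frame_surj fr a1 (- b3 - a1).
exists z, z'; rewrite /trap /= z1 z2 z1' z2'; split => //.
- by split; lra.
- by split; lra.
- by split; lra.
- lra.
Qed.

(** The maximum of X is attained at one vertex only. Together with trap_flat
this recovers the position of the trapezoid from the set of its points. *)
Lemma trap_sharp X Y a1 a2 a3 b3 z : frame X Y -> a3 < b3 -> b3 < - a1 - a2 ->
  trap X Y a1 a2 a3 b3 z ->
  (forall w, trap X Y a1 a2 a3 b3 w -> X w <= X z) -> Y z = a2.
Proof.
move=> fr ab ba [z1 z2 z3 z4].
have [w [w1 w2]] := frame_surj fr (- a3 - a2) a2.
move=> /(_ w); rewrite /trap /= w1 w2.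
have h : [/\ a1 <= - a3 - a2, a2 <= a2, a3 <= - (- a3 - a2 + a2) &
   - (- a3 - a2 + a2) <= b3] by split; lra.
by move=> /(_ h); lra.
Qed.

(** The maximum of - (X + Y) over a corner is attained at a single vertex. *)
Lemma corner_sharp X Y a1 b1 a2 a3 z : frame X Y ->
  corner X Y a1 b1 a2 a3 z ->
  (forall w, corner X Y a1 b1 a2 a3 w -> X z + Y z <= X w + Y w) -> X z = a1.
Proof.
move=> fr [z1 z2 z3 z4].
have [w [w1 w2]] := frame_surj fr a1 a2.
move=> /(_ w); rewrite /corner /= w1 w2.
have h : [/\ a1 <= a1, a1 <= b1, a2 <= a2 & a3 <= - (a1 + a2)] by split; lra.
by move=> /(_ h); lra.
Qed.

(** The maximum and the minimum of - (X + Y) over a trapezoid are attained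
along its bases, hence at several points, contrary to corner_sharp. *)
Lemma trap_neq_corner X Y a1 a2 a3 b3 X' Y' c1 d1 c2 c3 :
  frame X Y -> frame X' Y' -> a3 < b3 -> b3 < - a1 - a2 ->
  trap X Y a1 a2 a3 b3 <> corner X' Y' c1 d1 c2 c3.
Proof.
move=> fr fr' ab ba E.
have [z [z' [Fz Fz' [z1 z1'] [z3 z3'] _]]] := trap_flat fr ab ba.
have ba' : b3 < - a2 - a1 by lra.
have [w [w' []]] := trap_flat (frameC fr) ab ba'.
rewrite -trapC => Fw Fw' [w1 w1'] [w3 w3'] _.
have sharp t : trap X Y a1 a2 a3 b3 t ->
    (forall u, trap X Y a1 a2 a3 b3 u -> X' t + Y' t <= X' u + Y' u) -> X' t = c1.
  by rewrite E; exact: corner_sharp.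
have H t : trap X Y a1 a2 a3 b3 t -> a3 <= - (X t + Y t) <= b3.
  by case=> _ _ ? ?; apply/andP.
have top t s : trap X Y a1 a2 a3 b3 t -> trap X Y a1 a2 a3 b3 s ->
    (forall u, X' u + Y' u = X u + Y u) -> - (X t + Y t) = b3 ->
    - (X s + Y s) = b3 -> X' t = X' s.
  move=> Ft Fs e tb sb.
  by transitivity c1; [|symmetry]; apply: sharp => // u /H; rewrite !e; lra.
have bot t s : trap X Y a1 a2 a3 b3 t -> trap X Y a1 a2 a3 b3 s ->
    (forall u, X' u + Y' u = - (X u + Y u)) -> - (X t + Y t) = a3 ->
    - (X s + Y s) = a3 -> X' t = X' s.
  move=> Ft Fs e tb sb.
  by transitivity c1; [|symmetry]; apply: sharp => // u /H; rewrite !e; lra.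
rewrite [_ + X _]addrC in w3; rewrite [_ + X _]addrC in w3'.
case: (frame_rel fr fr') => -[eX eY].
- have : X' z' = X' w' by apply: top => // u; rewrite eX eY.
  by rewrite !eX; lra.
- have : X' z' = X' w' by apply: top => // u; rewrite eX eY addrC.
  by rewrite !eX; lra.
- have : X' z = X' w by apply: bot => // u; rewrite eX eY; ring.
  by rewrite !eX; lra.
- have : X' z = X' w by apply: bot => // u; rewrite eX eY; ring.
  by rewrite !eX; lra.
Qed.

(** Every cut of a corner leaves a corner on one side, whereas no tile is a
corner. *)
Lemma guillotine_not_corner a F : guillotine a F -> forall X Y, frame X Y ->
  forall a1 b1 a2 a3, F <> corner X Y a1 b1 a2 a3.
Proof.
elim=> {F} [X Y a1 a2 a3 b3 fr ab ba _ X' Y' fr' c1 d1 c2 c3|].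
  exact: trap_neq_corner.
move=> F F1 F2 FC _ IH1 _ IH2 X Y fr a1 b1 a2 a3 FE.
pose P := fun F => forall c1 d1 c2 c3, F <> corner X Y c1 d1 c2 c3.
have P1 : P F1 by exact: IH1.
have P2 : P F2 by exact: IH2.
case: (cut_frame fr FC) => /splits_both/(_ P1 P2)[c [_ _ + +]];
  rewrite FE => H H'.
- apply: (H (Num.max a1 c) b1 a2 a3); apply/seteqP; rewrite /corner.
  split=> z /=; rewrite ge_max.
    by move=> [[-> -> -> ->] ->].
  by move=> [/andP[-> ->] -> -> ->].
- apply: (H a1 b1 (Num.max a2 c) a3); apply/seteqP; rewrite /corner.
  split=> z /=; rewrite ge_max.
    by move=> [[-> -> -> ->] ->].
  by move=> [-> -> /andP[-> ->] ->].
- apply: (H' a1 b1 a2 (Num.max a3 (- c))); apply/seteqP; rewrite /corner.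
  split=> z /=; rewrite ge_max lerN2.
    by move=> [[-> -> -> ->] ->].
  by move=> [-> -> -> /andP[-> ->]].
Qed.

(** Otherwise the bound b3 would be void and the set a full triangle. *)
Lemma trap_nondegenerate a X Y a1 a2 a3 b3 : frame X Y ->
  guillotine a (trap X Y a1 a2 a3 b3) -> b3 < - a1 - a2.
Proof.
move=> fr g; rewrite ltNge; apply/negP => ab.
apply: (guillotine_not_corner g fr (a1 := a1) (b1 := - a2 - a3) (a2 := a2)
  (a3 := a3)).
rewrite /trap /corner; halfplanes.
Qed.

Lemma trap_inj X Y a1 a2 a3 b3 c1 c2 c3 d3 : frame X Y ->
  a3 < b3 -> b3 < - a1 - a2 -> c3 < d3 -> d3 < - c1 - c2 ->
  trap X Y a1 a2 a3 b3 = trap X Y c1 c2 c3 d3 ->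
  [/\ a1 = c1, a2 = c2, a3 = c3 & b3 = d3].
Proof.
have le p1 p2 p3 q3 r1 r2 r3 s3 X' Y' : frame X' Y' -> p3 < q3 ->
    q3 < - p1 - p2 -> trap X' Y' p1 p2 p3 q3 = trap X' Y' r1 r2 r3 s3 ->
    [/\ r1 <= p1, r3 <= p3 & q3 <= s3].
  move=> fr pq qp E.
  have [z [z' [+ + [<- e2] [<- <-] _]]] := trap_flat fr pq qp.
  by rewrite E => -[? _ ? _] [_ _ _ ?].
move=> fr ab ba cd dc E; have E' := E; rewrite ![trap X Y _ _ _ _]trapC in E'.
have ba' : b3 < - a2 - a1 by lra.
have dc' : d3 < - c2 - c1 by lra.
have [] := le _ _ _ _ _ _ _ _ _ _ fr ab ba E.
have [] := le _ _ _ _ _ _ _ _ _ _ fr cd dc (esym E).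
have [+ _ _] := le _ _ _ _ _ _ _ _ _ _ (frameC fr) ab ba' E'.
have [+ _ _] := le _ _ _ _ _ _ _ _ _ _ (frameC fr) cd dc' (esym E').
by move=> *; split; lra.
Qed.

Lemma trap_neq_opp X Y a1 a2 a3 b3 c1 c2 c3 d3 : frame X Y ->
  a3 < b3 -> b3 < - a1 - a2 -> c3 < d3 -> d3 < - c1 - c2 ->
  trap X Y a1 a2 a3 b3 <> trap (fun z => - X z) (fun z => - Y z) c1 c2 c3 d3.
Proof.
move=> fr ab ba cd dc E.
have [z [z' [+ + [zc zc'] _ yy]]] := trap_flat (frameN fr) cd dc.
rewrite -E => Fz Fz'.
have max w : trap X Y a1 a2 a3 b3 w -> X w <= - c1 by rewrite E => -[] /=; lra.
apply: yy; congr (- _); transitivity a2; [|symmetry].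
  by apply: (trap_sharp fr ab ba Fz) => w /max; lra.
by apply: (trap_sharp fr ab ba Fz') => w /max; lra.
Qed.

(** In a parallelogram both extrema of X' are attained along a side, in a
trapezoid only one of the extrema of each of X and Y is. *)
Lemma trap_neq_par X Y X' Y' a1 a2 a3 b3 c1 d1 c3 d3 : frame X Y ->
  frame X' Y' -> a3 < b3 -> b3 < - a1 - a2 -> c1 < d1 -> c3 < d3 ->
  trap X Y a1 a2 a3 b3 <> par X' Y' c1 d1 c3 d3.
Proof.
move=> fr fr' ab ba cd1 cd E.
have ba' : b3 < - a2 - a1 by lra.
have flat x : c1 <= x <= d1 -> exists z z',
    [/\ trap X Y a1 a2 a3 b3 z, trap X Y a1 a2 a3 b3 z',
    X' z = x, X' z' = x & Y' z <> Y' z'].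
  move=> /andP[cx xd].
  have [z [z1 z2]] := frame_surj fr' x (- c3 - x).
  have [w [w1 w2]] := frame_surj fr' x (- d3 - x).
  exists z, w; rewrite E /par /= z1 z2 w1 w2; split => //.
  - by split; lra.
  - by split; lra.
  - lra.
have H w : trap X Y a1 a2 a3 b3 w -> c1 <= X' w <= d1.
  by rewrite E => -[-> ->].
have [z [z' [Fz Fz' z1 z1' zz]]] : exists z z',
    [/\ trap X Y a1 a2 a3 b3 z, trap X Y a1 a2 a3 b3 z',
    X' z = c1, X' z' = c1 & Y' z <> Y' z'] by apply: flat; lra.
have [w [w' [Fw Fw' w1 w1' ww]]] : exists z z',
    [/\ trap X Y a1 a2 a3 b3 z, trap X Y a1 a2 a3 b3 z',
    X' z = d1, X' z' = d1 & Y' z <> Y' z'] by apply: flat; lra.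
have sharp t s : trap X Y a1 a2 a3 b3 t -> trap X Y a1 a2 a3 b3 s ->
    X t = X s -> (forall u, trap X Y a1 a2 a3 b3 u -> X u <= X t) -> Y t = Y s.
  move=> Ft Fs ts m; rewrite (trap_sharp fr ab ba Ft m).
  by rewrite (trap_sharp fr ab ba Fs) // -ts.
have sharp' t s : trap X Y a1 a2 a3 b3 t -> trap X Y a1 a2 a3 b3 s ->
    Y t = Y s -> (forall u, trap X Y a1 a2 a3 b3 u -> Y u <= Y t) -> X t = X s.
  rewrite trapC => Ft Fs ts m; rewrite (trap_sharp (frameC fr) ab ba' Ft m).
  by rewrite (trap_sharp (frameC fr) ab ba' Fs) // -ts.
case: (frame_rel fr fr') => -[eX eY]; rewrite !eX in z1 z1' w1 w1'.
- by apply: ww; rewrite !eY; apply: sharp; rewrite ?w1' // => u /H; rewrite eX; lra.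
- by apply: ww; rewrite !eY; apply: sharp'; rewrite ?w1' // => u /H; rewrite eX; lra.
- apply: zz; rewrite !eY; congr (- _); apply: sharp => //; first by lra.
  by move=> u /H; rewrite eX; lra.
- apply: zz; rewrite !eY; congr (- _); apply: sharp' => //; first by lra.
  by move=> u /H; rewrite eX; lra.
Qed.


(** The ratio is determined by the set of points, although the same trapezoid
is described in two frames. *)
Lemma trap_ratio_unique X Y X' Y' a1 a2 a3 b3 c1 c2 c3 d3 :
  frame X Y -> frame X' Y' ->
  a3 < b3 -> b3 < - a1 - a2 -> c3 < d3 -> d3 < - c1 - c2 ->
  trap X Y a1 a2 a3 b3 = trap X' Y' c1 c2 c3 d3 ->
  trap_ratio a1 a2 a3 b3 = trap_ratio c1 c2 c3 d3.
Proof.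
move=> fr fr' ab ba cd dc.
have dc' : d3 < - c2 - c1 by lra.
case: (frame_rel fr fr') => -[/funext-> /funext->].
- by case/(trap_inj fr ab ba cd dc) => -> -> -> ->.
- rewrite trapC trap_ratioC => E; have ba' : b3 < - a2 - a1 by lra.
  by have [-> -> -> ->] := trap_inj (frameC fr) ab ba' cd dc E.
- by move=> /trap_neq_opp; case.
- by rewrite [X in _ = X]trapC => /trap_neq_opp; case.
Qed.

(** The closure properties of a pair of predicates that make them hold for the
ratios of all the trapezoids and parallelograms of a guillotine tiling. *)
Section Invariance.
Variables (parP trapP : R -> Prop) (a : R).
Hypothesis trapP_a : trapP a.
Hypothesis parD : forall x y, parP x -> parP y -> parP (x + y).
Hypothesis par_harmonic :
  forall x y, parP x -> parP y -> parP (x * y / (x + y)).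
Hypothesis trap_par : forall x, trapP x -> parP x.
Hypothesis trapD : forall x y, parP x -> trapP y -> trapP (x + y).
Hypothesis trap_coth :
  forall x y, trapP x -> trapP y -> trapP ((1 + x * y) / (x + y)).

Let inv F := guillotine a F /\ forall X Y, frame X Y ->
  (forall a1 a2 a3 b3, F = trap X Y a1 a2 a3 b3 -> a3 < b3 ->
    trapP (trap_ratio a1 a2 a3 b3)) /\
  (forall a1 b1 a3 b3, F = par X Y a1 b1 a3 b3 -> a1 < b1 -> a3 < b3 ->
    parP (par_ratio a1 b1 a3 b3)).

Let inv_trap F X Y a1 a2 a3 b3 : inv F -> frame X Y ->
  F = trap X Y a1 a2 a3 b3 -> a3 < b3 ->
  b3 < - a1 - a2 /\ trapP (trap_ratio a1 a2 a3 b3).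
Proof.
move=> [g H] fr FE ab; split; last exact: (H _ _ fr).1.
by rewrite FE in g; exact: trap_nondegenerate g.
Qed.

Let inv_par F X Y a1 b1 a3 b3 : inv F -> frame X Y ->
  F = par X Y a1 b1 a3 b3 -> a1 < b1 -> a3 < b3 ->
  parP (par_ratio a1 b1 a3 b3).
Proof. by move=> [_ H] fr; exact: (H _ _ fr).2. Qed.

Let inv_corner F X Y a1 b1 a2 a3 : inv F -> frame X Y ->
  F <> corner X Y a1 b1 a2 a3.
Proof. by move=> [g _] fr; exact: guillotine_not_corner g _ _ fr _ _ _ _. Qed.

(** One piece is a parallelogram, the other a trapezoid: if the line left
through the other leg, one piece would be a triangle. *)
Let trap_cut_leg F F1 F2 X Y a1 a2 a3 b3 : inv F1 -> inv F2 -> frame X Y ->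
  F = trap X Y a1 a2 a3 b3 -> a3 < b3 -> splits X F F1 F2 ->
  trapP (trap_ratio a1 a2 a3 b3).
Proof.
move=> I1 I2 fr FE ab /(@splits_both inv)/(_ I1 I2)[c [_ [w Fw wc] Ihi Ilo]].
rewrite {}FE in Fw Ihi Ilo.
have ac : a1 < c by case: Fw; lra.
have hiE : trap X Y a1 a2 a3 b3 `&` [set z | c <= X z] = trap X Y c a2 a3 b3.
  rewrite /trap; halfplanes.
have [cb t] := inv_trap Ihi fr hiE ab.
have loE : trap X Y a1 a2 a3 b3 `&` [set z | X z <= c] = par X Y a1 c a3 b3.
  rewrite /trap /par; halfplanes.
have p := inv_par Ilo fr loE ac ab.
have -> : trap_ratio a1 a2 a3 b3 = par_ratio a1 c a3 b3 + trap_ratio c a2 a3 b3.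
  by rewrite /trap_ratio /par_ratio; field; lra.
exact: trapD.
Qed.

(** With x, y, t the widths along the three horizontal lines, the ratios are
(x + y) / (x - y), (y + t) / (y - t) and (x + t) / (x - t). *)
Let trap_cut_base F F1 F2 X Y a1 a2 a3 b3 : inv F1 -> inv F2 -> frame X Y ->
  F = trap X Y a1 a2 a3 b3 -> splits (fun z => X z + Y z) F F1 F2 ->
  trapP (trap_ratio a1 a2 a3 b3).
Proof.
move=> I1 I2 fr FE.
move=> /(@splits_both inv)/(_ I1 I2)[c [[z Fz zc] [w Fw wc] Ihi Ilo]].
rewrite {}FE in Fz Fw Ihi Ilo.
have ac : a3 < - c by case: Fz; lra.
have cb : - c < b3 by case: Fw; lra.
have hiE : trap X Y a1 a2 a3 b3 `&` [set z | c <= X z + Y z] =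
    trap X Y a1 a2 a3 (- c).
  rewrite /trap; halfplanes.
have loE : trap X Y a1 a2 a3 b3 `&` [set z | X z + Y z <= c] =
    trap X Y a1 a2 (- c) b3.
  rewrite /trap; halfplanes.
have [_ t1] := inv_trap Ihi fr hiE ac.
have [ba t2] := inv_trap Ilo fr loE cb.
have := trap_coth t1 t2; congr trapP.
rewrite /trap_ratio.
set m := - c in ac cb *; set W := - a1 - a2 in ba.
have -> : - 2 * a1 - 2 * a2 - a3 - m = (W - a3) + (W - m) by rewrite /W; ring.
have -> : - 2 * a1 - 2 * a2 - m - b3 = (W - m) + (W - b3) by rewrite /W; ring.
have -> : - 2 * a1 - 2 * a2 - a3 - b3 = (W - a3) + (W - b3) by rewrite /W; ring.
have -> : m - a3 = (W - a3) - (W - m) by ring.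
have -> : b3 - m = (W - m) - (W - b3) by ring.
have -> : b3 - a3 = (W - a3) - (W - b3) by ring.
have : 0 < W - b3 by lra.
have : W - b3 < W - m by lra.
have : W - m < W - a3 by lra.
move: (W - a3) (W - m) (W - b3) => x y t xy yt t0.
have n1 : x - y != 0 by lra.
have n2 : y - t != 0 by lra.
have n3 : x - t != 0 by lra.
have y0 : y != 0 by lra.
have -> : 1 + (x + y) / (x - y) * ((y + t) / (y - t)) =
    2 * y * (x + t) / ((x - y) * (y - t)).
  by field; rewrite n1 n2.
have -> : (x + y) / (x - y) + (y + t) / (y - t) =
    2 * y * (x - t) / ((x - y) * (y - t)).
  by field; rewrite n1 n2.
by field; rewrite n1 n2 n3 y0.
Qed.

Let par_cut_leg F F1 F2 X Y a1 b1 a3 b3 : inv F1 -> inv F2 -> frame X Y ->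
  F = par X Y a1 b1 a3 b3 -> a3 < b3 -> splits X F F1 F2 ->
  parP (par_ratio a1 b1 a3 b3).
Proof.
move=> I1 I2 fr FE ab.
move=> /(@splits_both inv)/(_ I1 I2)[c [[z Fz zc] [w Fw wc] Ihi Ilo]].
rewrite {}FE in Fz Fw Ihi Ilo.
have ac : a1 < c by case: Fw; lra.
have cb : c < b1 by case: Fz; lra.
have hiE : par X Y a1 b1 a3 b3 `&` [set z | c <= X z] = par X Y c b1 a3 b3.
  rewrite /par; halfplanes.
have loE : par X Y a1 b1 a3 b3 `&` [set z | X z <= c] = par X Y a1 c a3 b3.
  rewrite /par; halfplanes.
have p := inv_par Ihi fr hiE cb ab; have q := inv_par Ilo fr loE ac ab.
have := parD p q; congr parP.
by rewrite /par_ratio; field; lra.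
Qed.

Let par_cut_base F F1 F2 X Y a1 b1 a3 b3 : inv F1 -> inv F2 -> frame X Y ->
  F = par X Y a1 b1 a3 b3 -> a1 < b1 -> splits (fun z => X z + Y z) F F1 F2 ->
  parP (par_ratio a1 b1 a3 b3).
Proof.
move=> I1 I2 fr FE ab1.
move=> /(@splits_both inv)/(_ I1 I2)[c [[z Fz zc] [w Fw wc] Ihi Ilo]].
rewrite {}FE in Fz Fw Ihi Ilo.
have ac : a3 < - c by case: Fz; lra.
have cb : - c < b3 by case: Fw; lra.
have hiE : par X Y a1 b1 a3 b3 `&` [set z | c <= X z + Y z] =
    par X Y a1 b1 a3 (- c).
  rewrite /par; halfplanes.
have loE : par X Y a1 b1 a3 b3 `&` [set z | X z + Y z <= c] =
    par X Y a1 b1 (- c) b3.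
  rewrite /par; halfplanes.
have p := inv_par Ihi fr hiE ab1 ac; have q := inv_par Ilo fr loE ab1 cb.
have := par_harmonic p q; congr parP; rewrite /par_ratio.
have n1 : b1 - a1 != 0 by lra.
have n2 : - c - a3 != 0 by lra.
have n3 : b3 - - c != 0 by lra.
have n4 : b3 - a3 != 0 by lra.
have -> : 2 * (b1 - a1) / (- c - a3) + 2 * (b1 - a1) / (b3 - - c) =
    2 * (b1 - a1) * (b3 - a3) / ((- c - a3) * (b3 - - c)).
  by field; rewrite n2 n3.
by field; rewrite n1 n2 n3 n4.
Qed.

(** A line parallel to neither side of the parallelogram either meets both bases
and leaves two trapezoids, or leaves a corner on one side. *)
Let par_cut_diagonal F F1 F2 X Y a1 b1 a3 b3 : inv F1 -> inv F2 -> frame X Y ->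
  F = par X Y a1 b1 a3 b3 -> a1 < b1 -> a3 < b3 -> splits Y F F1 F2 ->
  parP (par_ratio a1 b1 a3 b3).
Proof.
move=> I1 I2 fr FE ab1 ab.
move=> /(@splits_both inv)/(_ I1 I2)[c [[z Fz zc] [w Fw wc] Ihi Ilo]].
rewrite {}FE in Fz Fw Ihi Ilo.
have [h1|h1] := leP (- c) (a1 + b3).
  have E : par X Y a1 b1 a3 b3 `&` [set z | c <= Y z] = corner X Y a1 b1 c a3.
    rewrite /par /corner; halfplanes.
  by case: (inv_corner Ihi fr E).
have [h2|h2] := leP (b1 + a3) (- c).
  have E : par X Y a1 b1 a3 b3 `&` [set z | Y z <= c] =
      corner (fun z => - X z) (fun z => - Y z) (- b1) (- a1) (- c) (- b3).
    rewrite /par /corner; halfplanes.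
  by case: (inv_corner Ilo (frameN fr) E).
have hiE : par X Y a1 b1 a3 b3 `&` [set z | c <= Y z] = trap X Y a1 c a3 b3.
  rewrite /par /trap; halfplanes.
have loE : par X Y a1 b1 a3 b3 `&` [set z | Y z <= c] =
    trap (fun z => - X z) (fun z => - Y z) (- b1) (- c) (- b3) (- a3).
  rewrite /par /trap; halfplanes.
have nab : - b3 < - a3 by lra.
have [_ t1] := inv_trap Ihi fr hiE ab.
have [_ t2] := inv_trap Ilo (frameN fr) loE nab.
have := parD (trap_par t1) (trap_par t2); congr parP.
by rewrite /trap_ratio /par_ratio; field; lra.
Qed.

Lemma guillotine_trap_ratio F X Y a1 a2 a3 b3 : guillotine a F ->
  frame X Y -> F = trap X Y a1 a2 a3 b3 -> a3 < b3 ->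
  trapP (trap_ratio a1 a2 a3 b3).
Proof.
move=> g fr FE ab; suff I : inv F by have [] := inv_trap I fr FE ab.
elim: g => {F X Y a1 a2 a3 b3 fr FE ab}
  [X Y a1 a2 a3 b3 fr ab ba ra|F F1 F2 FC g1 I1 g2 I2].
  have g : guillotine a (trap X Y a1 a2 a3 b3) by exact: guillotine_tile.
  split => // X' Y' fr'; split => c1 c2 c3 d3 E.
    move=> cd; have dc : d3 < - c1 - c2.
      by rewrite E in g; exact: trap_nondegenerate g.
    by rewrite -(trap_ratio_unique fr fr' ab ba cd dc E) ra.
  by move=> cd1 cd; case: (trap_neq_par fr fr' ab ba cd1 cd E).
have g : guillotine a F by exact: guillotine_cut FC g1 g2.
split => // X Y fr; split => c1 c2 c3 d3 E.
  move=> cd; case: (cut_frame fr FC) => S.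
  - exact: trap_cut_leg I1 I2 fr E cd S.
  - by rewrite trapC in E; rewrite trap_ratioC;
      exact: trap_cut_leg I1 I2 (frameC fr) E cd S.
  - exact: trap_cut_base I1 I2 fr E S.
move=> cd1 cd; case: (cut_frame fr FC) => S.
- exact: par_cut_leg I1 I2 fr E cd S.
- exact: par_cut_diagonal I1 I2 fr E cd1 cd S.
- exact: par_cut_base I1 I2 fr E cd1 S.
Qed.

End Invariance.
End GuillotineTilings.

(** * Cutting a convex figure along a segment *)

Section PlaneCuts.
Variable R : realType.
Implicit Types (u v x y z p q : plane R) (F S : set (plane R)) (c t : R).

Lemma dot_comb v x y (a b : R) :
  dot v (a *: x + b *: y) = a * dot v x + b * dot v y.
Proof.
case: v x y => v1 v2 [x1 x2] [y1 y2]; rewrite /dot /=.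
change (v1 * (a * x1 + b * y1) + v2 * (a * x2 + b * y2) =
  a * (v1 * x1 + v2 * x2) + b * (v1 * y1 + v2 * y2)); ring.
Qed.

Lemma dotDl u v z : dot (u + v) z = dot u z + dot v z.
Proof. by case: u v z => [u1 u2] [v1 v2] [z1 z2]; rewrite /dot /=; ring. Qed.

Lemma dotxx_gt0 v : v != 0 -> 0 < dot v v.
Proof.
case: v => v1 v2 v0; rewrite /dot /= lt_neqAle addr_ge0 -?expr2 ?sqr_ge0 //.
rewrite andbT eq_sym paddr_eq0 ?sqr_ge0 // !sqrf_eq0; apply: contra v0.
by move=> /andP[/eqP-> /eqP->].
Qed.

Lemma dot_continuous v : continuous (dot v : plane R -> R).
Proof.
move=> z; rewrite /dot; apply: cvgD; apply: cvgM; try exact: cvg_cst.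
  exact: cvg_fst.
exact: cvg_snd.
Qed.

Lemma segment_continuous p q :
  continuous (fun t : R => (1 - t) *: p + t *: q : plane R).
Proof.
move=> t; apply: cvgD.
  apply: cvgZ; last exact: cvg_cst.
  by apply: cvgB; [exact: cvg_cst|exact: cvg_id].
by apply: cvgZ; [exact: cvg_id|exact: cvg_cst].
Qed.

(** Stated with segments, the form in which it is used for cuts; it agrees with
convex_set by convex_setE below. *)
Definition convex F : Prop := forall x y, F x -> F y -> segment x y `<=` F.

Lemma figure_closed F : figure F -> closed F.
Proof. by case=> _ _ <-; exact: closed_closure. Qed.

(** A figure has interior points, and a line has none. *)
Lemma figure_off_line F v c : figure F -> v != 0 ->
  exists2 z, F z & dot v z != c.
Proof.
move=> [F0 _ Fi] v0.
have [z zi] : (interior F) !=set0.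
  apply/set0P/eqP => E; move: F0; rewrite -Fi E closure0.
  by case.
have [zc|zc] := boolP (dot v z != c).
  by exists z => //; exact: interior_subset zi.
have g0 : (1 - 0) *: z + 0 *: (z + v) = z :> plane R.
  by rewrite subr0 scale1r scale0r addr0.
have : nbhs (0 : R) [set t : R | F ((1 - t) *: z + t *: (z + v))].
  by apply: (segment_continuous (p := z) (q := z + v)); rewrite g0.
move=> /nbhs_ballP[r /= r0 rF].
exists ((1 - r / 2) *: z + (r / 2) *: (z + v)).
  apply: rF; rewrite /ball /= sub0r normrN gtr0_norm; lra.
rewrite dot_comb -[X in dot v (X + v)]scale1r -[X in dot v (_ + X)]scale1r.
rewrite dot_comb.
move: zc; rewrite negbK => /eqP->.
have : 0 < r / 2 * dot v v by apply: mulr_gt0; [lra|exact: dotxx_gt0].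
by move=> h; apply/eqP; lra.
Qed.

(** A segment is connected, so it cannot be covered by two disjoint closed sets
that contain its ends. *)
Lemma crossing F1 F2 x y : closed F1 -> closed F2 -> F1 x -> F2 y ->
  segment x y `<=` F1 `|` F2 ->
  exists2 t : R, 0 <= t <= 1 & (F1 `&` F2) ((1 - t) *: x + t *: y).
Proof.
move=> c1 c2 Fx Fy xy.
pose g := fun t : R => (1 - t) *: x + t *: y : plane R.
have gc : continuous g by exact: segment_continuous.
have g0 : g 0 = x by rewrite /g subr0 scale1r scale0r addr0.
have g1 : g 1 = y by rewrite /g subrr scale1r scale0r add0r.
have gF t : 0 <= t <= 1 -> (F1 `|` F2) (g t).
  by move=> t01; apply: xy; exists t.
apply: contrapT => H.
have N t : 0 <= t <= 1 -> ~ (F1 (g t) /\ F2 (g t)).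
  by move=> t01 ?; apply: H; exists t.
have E : `[0, 1]%classic `&` g @^-1` F1 = `[0 : R, 1]%classic.
  apply: (@segment_connected R 0 1).
  - exists 0; split; rewrite /= ?g0 // in_itv /= lexx ler01 //.
  - exists (g @^-1` (~` F2)).
      by apply: open_comp => [? _|]; [exact: gc|exact: closed_openC].
    apply/seteqP; split => t /=; rewrite in_itv /= => -[t01 ?]; split => //.
      by move=> ?; exact: (N t).
    by case: (gF t).
  - by exists (g @^-1` F1) => //; apply: closed_comp => // ? _; exact: gc.
have : `[0 : R, 1]%classic (1 : R) by rewrite /= in_itv /= lexx ler01.
rewrite -E => -[_ /= F1y]; apply: (N 1); first by rewrite lexx ler01.
by rewrite g1 in F1y *.
Qed.

Lemma convex_halfplane F v c : convex F ->
  convex (F `&` [set z | c <= dot v z]) /\ convex (F `&` [set z | dot v z <= c]).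
Proof.
move=> cF; split=> x y [Fx /= cx] [Fy /= cy] z xyz;
  (split; first exact: cF xyz); case: xyz => t /andP[t0 t1] <- /=;
  rewrite dot_comb.
  have : 0 <= (1 - t) * (dot v x - c) by apply: mulr_ge0; lra.
  have : 0 <= t * (dot v y - c) by apply: mulr_ge0; lra.
  lra.
have : 0 <= (1 - t) * (c - dot v x) by apply: mulr_ge0; lra.
have : 0 <= t * (c - dot v y) by apply: mulr_ge0; lra.
lra.
Qed.

(** A point of F strictly on the side of z belongs to F1: the segment from z to
a point of F2 on the same side could not meet the line. A point x of F2 on the
line itself also belongs to F1, since the segment from z to x meets the line at
x only. *)
Lemma cover_halfplanes F F1 F2 v c z w : closed F1 -> closed F2 -> convex F ->
  F1 `|` F2 = F -> (forall x, (F1 `&` F2) x -> dot v x = c) ->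
  F1 z -> c < dot v z -> F2 w -> dot v w < c ->
  F1 = F `&` [set x | c <= dot v x] /\ F2 = F `&` [set x | dot v x <= c].
Proof.
move=> cl1 cl2 cF FE Sc Fz zc Fw wc.
have cross x y : F1 x -> F2 y -> exists2 t : R, 0 <= t <= 1 &
    (1 - t) * dot v x + t * dot v y = c /\
    (F1 `&` F2) ((1 - t) *: x + t *: y).
  move=> Fx Fy; have [|t t01 Ft] := crossing cl1 cl2 Fx Fy.
    by rewrite FE; apply: cF; rewrite -FE; [left|right].
  by exists t => //; split => //; rewrite -dot_comb; exact: Sc.
have split_ab (r s t : R) : 0 <= t <= 1 -> (1 - t) * r + t * s = c ->
    (1 - t) * (r - c) + t * (s - c) = 0 /\ 0 <= 1 - t /\ 0 <= t.
  by move=> /andP[? ?] ?; split; [lra|split; lra].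
have zdc : 0 < dot v z - c by lra.
have wdc : 0 < c - dot v w by lra.
have up x : F x -> c <= dot v x -> F1 x.
  rewrite -FE => -[//|Fx] cx.
  have [t t01 [/(split_ab _ _ _ t01)[e [t0 t1]] Ft]] := cross _ _ Fz Fx.
  have e1 : 0 <= t * (dot v x - c) by apply: mulr_ge0; lra.
  have e2 : 0 <= (1 - t) * (dot v z - c) by apply: mulr_ge0; lra.
  have /eqP : (1 - t) * (dot v z - c) = 0 by lra.
  rewrite mulf_eq0 (gt_eqF zdc) orbF => /eqP t1'.
  have tE : t = 1 by lra.
  by move: Ft; rewrite tE subrr scale0r scale1r add0r => -[].
have dn x : F x -> dot v x <= c -> F2 x.
  rewrite -FE => -[Fx|//] cx.
  have [t t01 [/(split_ab _ _ _ t01)[e [t0 t1]] Ft]] := cross _ _ Fx Fw.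
  have e1 : 0 <= (1 - t) * (c - dot v x) by apply: mulr_ge0; lra.
  have e2 : 0 <= t * (c - dot v w) by apply: mulr_ge0; lra.
  have /eqP : t * (c - dot v w) = 0 by lra.
  rewrite mulf_eq0 (gt_eqF wdc) orbF => /eqP t1'.
  by move: Ft; rewrite t1' subr0 scale0r scale1r addr0 => -[].
split; apply/seteqP; split => x /=.
- move=> Fx; have xF : F x by rewrite -FE; left.
  split => //; rewrite leNgt; apply/negP => xc.
  have := Sc x (conj Fx (dn x xF (ltW xc))); lra.
- by case; exact: up.
- move=> Fx; have xF : F x by rewrite -FE; right.
  split => //; rewrite leNgt; apply/negP => xc.
  have := Sc x (conj (up x xF (ltW xc)) Fx); lra.
- by case; exact: dn.
Qed.

Lemma comb_gt0 (r s t : R) : 0 < r -> 0 < s -> 0 <= t <= 1 ->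
  0 < (1 - t) * r + t * s.
Proof.
move=> r0 s0 /andP[t0 t1]; have [t2|t2] := leP t 2^-1.
  have : 0 < (1 - t) * r by apply: mulr_gt0; lra.
  have : 0 <= t * s by apply: mulr_ge0; lra.
  lra.
have : 0 <= (1 - t) * r by apply: mulr_ge0; lra.
have : 0 < t * s by apply: mulr_gt0; lra.
lra.
Qed.

(** A segment that divides a convex figure runs along the whole chord, and the
two parts are the pieces of the figure on the two sides of the chord. *)
Lemma divides_halfplanes F F1 F2 p q v : convex F -> v != 0 ->
  dot v p = dot v q -> divides (segment p q) F F1 F2 ->
  splits (dot v) F F1 F2.
Proof.
move=> cF v0 pq [fig1 fig2 FE SE]; pose c := dot v p.
have Sc z : (F1 `&` F2) z -> dot v z = c.
  rewrite SE => -[t _ <-]; rewrite dot_comb -pq /c; ring.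
have Sc' z : (F2 `&` F1) z -> dot v z = c by rewrite setIC; exact: Sc.
have cl1 := figure_closed fig1; have cl2 := figure_closed fig2.
have [z Fz zc] := figure_off_line c fig1 v0.
have [w Fw wc] := figure_off_line c fig2 v0.
have zF : F z by rewrite -FE; left.
have wF : F w by rewrite -FE; right.
have [|t t01 /Sc] := crossing cl1 cl2 Fz Fw.
  by rewrite FE; exact: cF.
rewrite dot_comb => e; exists c.
case: (ltgtP (dot v z) c) zc => // zc _; case: (ltgtP (dot v w) c) wc => // wc _.
- have zc' : 0 < c - dot v z by lra.
  have wc' : 0 < c - dot v w by lra.
  have := comb_gt0 zc' wc' t01; lra.
- split; [by exists w|by exists z|right].
  by apply: (cover_halfplanes (z := w) (w := z)) => //; rewrite setUC.
- split; [by exists z|by exists w|left].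
  exact: (cover_halfplanes (z := z) (w := w)).
- have zc' : 0 < dot v z - c by lra.
  have wc' : 0 < dot v w - c by lra.
  have := comb_gt0 zc' wc' t01; lra.
Qed.

End PlaneCuts.

(** * From trivial tilings to guillotine tilings *)

Section TrivialTilings.
Variable R : realType.
Implicit Types (e v z p q : plane R) (F t : set (plane R)).

(** Inward normals of the left and right legs of an upright trapezoid with bases
parallel to e; their sum is the outward normal - 2 n of the lower base, where n
is e turned by 90 degrees. *)
Definition left_normal e : plane R := (e.1 + e.2, e.2 - e.1).
Definition right_normal e : plane R := (e.2 - e.1, - e.1 - e.2).

Local Notation lform e := (dot (left_normal e)).
Local Notation rform e := (dot (right_normal e)).

Lemma lformE e z : lform e z = dot e z - cross e z.
Proof. by case: e z => e1 e2 [z1 z2]; rewrite /dot /cross /=; ring. Qed.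

Lemma rformE e z : rform e z = - dot e z - cross e z.
Proof. by case: e z => e1 e2 [z1 z2]; rewrite /dot /cross /=; ring. Qed.

Lemma normals_surj e : e != 0 ->
  forall x y, exists z, lform e z = x /\ rform e z = y.
Proof.
move=> /dotxx_gt0; case: e => e1 e2; rewrite /dot /= => e0 x y.
have n0 : e1 * e1 + e2 * e2 != 0 by lra.
exists (((e1 + e2) * x + (e2 - e1) * y) / (2 * (e1 * e1 + e2 * e2)),
  ((e2 - e1) * x - (e1 + e2) * y) / (2 * (e1 * e1 + e2 * e2))).
by rewrite /dot /=; split; field.
Qed.

Definition normal e v : Prop :=
  [\/ v = left_normal e, v = right_normal e |
      v = left_normal e + right_normal e].

Lemma normal_neq0 e v : e != 0 -> normal e v -> v != 0.
Proof.
move=> e0 nv; have S := normals_surj e0.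
have : exists z, dot v z = 1.
  case: nv => ->.
  - by have [z []] := S 1 0; exists z.
  - by have [z []] := S 0 1; exists z.
  - by have [z [z1 z2]] := S 1 0; exists z; rewrite dotDl z1 z2 addr0.
move=> [z zv]; apply: contra_eq_neq zv => ->.
by rewrite /dot /= !mul0r addr0 eq_sym oner_eq0.
Qed.

Lemma frame_continuous e X Y : frame (lform e) (rform e) X Y -> continuous X.
Proof.
by case=> z; rewrite /=; try apply: continuousN; exact: dot_continuous.
Qed.

(** A point of a trapezoid satisfying all the inequalities strictly is an
interior point. *)
Lemma trap_boundary e X Y a1 a2 a3 b3 z : frame (lform e) (rform e) X Y ->
  boundary (trap X Y a1 a2 a3 b3) z ->
  [\/ X z = a1, Y z = a2, - (X z + Y z) = a3 | - (X z + Y z) = b3].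
Proof.
move=> fr; have cX := frame_continuous fr.
have cY := frame_continuous (frameC fr).
have cXY : continuous (fun z => - (X z + Y z)).
  by move=> t; apply: cvgN; apply: cvgD; [exact: cX|exact: cY].
have cl f c : continuous f -> closed [set z : plane R | c <= f z :> R].
  by move=> cf; apply: (closed_comp (f := f)) (@closed_ge R c) => ? _; exact: cf.
have cl' f c : continuous f -> closed [set z : plane R | f z <= c :> R].
  by move=> cf; apply: (closed_comp (f := f)) (@closed_le R c) => ? _; exact: cf.
have op f c : continuous f -> open [set z : plane R | c < f z :> R].
  by move=> cf; apply: (open_comp (f := f)) (@open_gt R c) => ? _; exact: cf.
have op' f c : continuous f -> open [set z : plane R | f z < c :> R].
  by move=> cf; apply: (open_comp (f := f)) (@open_lt R c) => ? _; exact: cf.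
rewrite /boundary => -[].
have -> : closure (trap X Y a1 a2 a3 b3) = trap X Y a1 a2 a3 b3.
  apply/esym/closure_id.
  have -> : trap X Y a1 a2 a3 b3 = [set z | a1 <= X z] `&` [set z | a2 <= Y z]
      `&` [set z | a3 <= - (X z + Y z)] `&` [set z | - (X z + Y z) <= b3].
    by apply/seteqP; split => t /=; [case|move=> [[[]]]].
  by repeat apply: closedI; [exact: cl|exact: cl|exact: cl|exact: cl'].
move=> [z1 z2 z3 z4] nI; apply: contrapT => H; apply: nI.
pose O := [set z | a1 < X z] `&` [set z | a2 < Y z]
      `&` [set z | a3 < - (X z + Y z)] `&` [set z | - (X z + Y z) < b3].
have oO : open O.
  by repeat apply: openI; [exact: op|exact: op|exact: op|exact: op'].
have OT : O `<=` trap X Y a1 a2 a3 b3.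
  by move=> t [[[]]] /= *; split; exact: ltW.
rewrite (open_subsetE _ oO) in OT; apply: OT.
have lt (r s : R) : r <= s -> s <> r -> r < s.
  by move=> rs /eqP sr; rewrite lt_neqAle rs eq_sym sr.
have lt' (r s : R) : r <= s -> r <> s -> r < s.
  by move=> rs /eqP sr; rewrite lt_neqAle rs sr.
split; [split; [split|]|] => /=.
- by apply: lt => // ?; apply: H; apply: Or41.
- by apply: lt => // ?; apply: H; apply: Or42.
- by apply: lt => // ?; apply: H; apply: Or43.
- by apply: lt' => // ?; apply: H; apply: Or44.
Qed.

Definition tile e a t : Prop := exists X Y a1 a2 a3 b3,
  [/\ frame (lform e) (rform e) X Y, a3 < b3, b3 < - a1 - a2,
      trap_ratio a1 a2 a3 b3 = a & t = trap X Y a1 a2 a3 b3].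

Lemma tile_boundary e a t : tile e a t -> exists s : seq (plane R * R),
  (forall i, i \in s -> normal e i.1) /\
  (forall z, boundary t z -> exists2 i, i \in s & dot i.1 z = i.2).
Proof.
move=> [X [Y [a1 [a2 [a3 [b3 [fr _ _ _ ->]]]]]]].
have B z := trap_boundary (z := z) (a1 := a1) (a2 := a2) (a3 := a3) (b3 := b3) fr.
pose l := left_normal e; pose r := right_normal e.
pose S c1 c2 c3 d3 := [:: (l, c1); (r, c2); (l + r, c3); (l + r, d3)] : seq (plane R * R).
have SN c1 c2 c3 d3 i : i \in S c1 c2 c3 d3 -> normal e i.1.
  rewrite !inE => /or4P[] /eqP->.
  - exact: Or31.
  - exact: Or32.
  - exact: Or33.
  - exact: Or33.
have S1 c1 c2 c3 d3 : (l, c1) \in S c1 c2 c3 d3 by rewrite !inE eqxx.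
have S2 c1 c2 c3 d3 : (r, c2) \in S c1 c2 c3 d3 by rewrite !inE eqxx ?orbT.
have S3 c1 c2 c3 d3 : (l + r, c3) \in S c1 c2 c3 d3 by rewrite !inE eqxx ?orbT.
have S4 c1 c2 c3 d3 : (l + r, d3) \in S c1 c2 c3 d3 by rewrite !inE eqxx ?orbT.
have [c1 [c2 [c3 [d3 H]]]] : exists c1 c2 c3 d3, forall z,
    boundary (trap X Y a1 a2 a3 b3) z ->
    [\/ lform e z = c1, rform e z = c2, lform e z + rform e z = c3 |
        lform e z + rform e z = d3].
  case: fr B => B.
  - exists a1, a2, (- a3), (- b3) => z /B[] h;
      [apply: Or41|apply: Or42|apply: Or43|apply: Or44]; lra.
  - exists a2, a1, (- a3), (- b3) => z /B[] h;
      [apply: Or42|apply: Or41|apply: Or43|apply: Or44]; lra.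
  - exists (- a1), (- a2), a3, b3 => z /B[] h;
      [apply: Or41|apply: Or42|apply: Or43|apply: Or44]; lra.
  - exists (- a2), (- a1), a3, b3 => z /B[] h;
      [apply: Or42|apply: Or41|apply: Or43|apply: Or44]; lra.
exists (S c1 c2 c3 d3); split; first exact: SN.
move=> z /H[] h.
- by exists (l, c1).
- by exists (r, c2).
- by exists (l + r, c3) => //=; rewrite dotDl.
- by exists (l + r, d3) => //=; rewrite dotDl.
Qed.

Lemma infinite_unit_interval : infinite_set [set t : R | 0 <= t <= 1].
Proof.
move=> fin; apply: infinite_nat.
have -> : [set: nat] = (fun n => n.+1%:R^-1 : R) @^-1` [set t | 0 <= t <= 1].
  apply/seteqP; split => n //= _.
  by rewrite invr_ge0 ler0n invf_le1 ?ltr0n // ler1n.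
apply: finite_preimage fin => m n _ _ /invr_inj/eqP.
by rewrite eqr_nat eqSS => /eqP.
Qed.

(** Otherwise each of the finitely many lines carrying sides of tiles would
meet the segment at most once, and the segment would be finite. *)
Lemma cut_direction e a (T : set (set (plane R))) p q : finite_set T ->
  (forall t, T t -> tile e a t) ->
  segment p q `<=` \bigcup_(t in T) boundary t ->
  exists2 v, normal e v & dot v p = dot v q.
Proof.
move=> finT Tt pqT; apply: contrapT => H.
apply: infinite_unit_interval.
pose g (s : R) := (1 - s) *: p + s *: q : plane R.
apply: (@sub_finite_set _ _ (\bigcup_(t in T) [set s : R | boundary t (g s)])).
  by move=> s s01; have [|t Tt' bt] := pqT (g s); [exists s|exists t].
apply: bigcup_finite => // t /Tt/tile_boundary[S [SN SB]].
apply: (@sub_finite_set _ _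
    (\bigcup_(i in [set` S]) [set s : R | dot i.1 (g s) = i.2])).
  by move=> s /SB[i iS iE]; exists i.
apply: bigcup_finite; first exact: finite_seq.
move=> i /= /SN ni.
have pq : dot i.1 q - dot i.1 p != 0.
  by rewrite subr_eq0; apply/eqP => pq; apply: H; exists i.1.
apply: (@sub_finite_set _ _ [set (i.2 - dot i.1 p) / (dot i.1 q - dot i.1 p)]).
  move=> s /=; rewrite dot_comb => <-; field => //.
exact: finite_set1.
Qed.

Lemma trivial_tiling_guillotine e a F T : e != 0 -> trivial_tiling F T ->
  (forall t, T t -> tile e a t) -> convex F ->
  guillotine (lform e) (rform e) a F.
Proof.
move=> e0; elim=> {F T} [F _ H _|F T p q F1 F2 [finT _ _ _] _ pqT FD _ IH1 _ IH2 H cF].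
  have [X [Y [a1 [a2 [a3 [b3 [fr ab ba ra ->]]]]]]] := H F erefl.
  exact: guillotine_tile.
have [v nv pq] := cut_direction finT H pqT.
have S := divides_halfplanes cF (normal_neq0 e0 nv) pq FD.
have [cF1 cF2] : convex F1 /\ convex F2.
  have [c [_ _]] := S; have [? ?] := convex_halfplane v c cF.
  by case=> -[-> ->].
have g1 : guillotine (lform e) (rform e) a F1.
  by apply: IH1 => // t [/H].
have g2 : guillotine (lform e) (rform e) a F2.
  by apply: IH2 => // t [/H].
apply: guillotine_cut g1 g2.
case: nv S => ->; [by apply: Or31|by apply: Or32|].
have -> : dot (left_normal e + right_normal e) =
    (fun z => lform e z + rform e z) by apply/funext => z; rewrite dotDl.
by apply: Or33.
Qed.

End TrivialTilings.

(** * Angles, heights and hulls in orthonormal coordinates *)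

Section TrapezoidCoordinates.
Variable R : realType.
Implicit Types (e u v x y z p q r s : plane R) (F : set (plane R)).

Local Notation lform e := (dot (left_normal e)).
Local Notation rform e := (dot (right_normal e)).

Lemma convex_setE F : @convex_set R (plane R) F <-> convex F.
Proof.
split=> cF.
  move=> x y Fx Fy z [t /andP[t0 t1] <-].
  have t0' : 0 <= 1 - t by lra.
  have t1' : 1 - t <= 1 by lra.
  have := cF x y (Itv01 t0' t1'); rewrite !inE => /(_ Fx Fy).
  by rewrite /conv /= /unstable.onem subKr.
move=> x y l; rewrite !inE => Fx Fy.
apply: (cF _ _ Fy Fx).
exists l%:num; first by apply/andP; split.
by rewrite /conv /= /unstable.onem addrC.
Qed.

Lemma crossE e z : cross e z = dot (- e.2, e.1) z.
Proof. by rewrite /cross /dot /=; ring. Qed.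

Lemma cross_comb e x y (a b : R) :
  cross e (a *: x + b *: y) = a * cross e x + b * cross e y.
Proof. by rewrite !crossE dot_comb. Qed.

Lemma dotB e x y : dot e (x - y) = dot e x - dot e y.
Proof. by case: e x y => [? ?] [? ?] [? ?]; rewrite /dot /=; ring. Qed.

Lemma crossB e x y : cross e (x - y) = cross e x - cross e y.
Proof. by rewrite !crossE dotB. Qed.

Lemma enorm_sq x : enorm x ^+ 2 = dot x x.
Proof. by rewrite sqr_sqrtr // /dot addr_ge0 // -expr2 sqr_ge0. Qed.

(** Lagrange's identity, the quantitative form of the Cauchy-Schwarz
inequality. *)
Lemma lagrange x y : dot x x * dot y y = dot x y ^+ 2 + cross x y ^+ 2.
Proof. by case: x y => [? ?] [? ?]; rewrite /dot /cross /=; ring. Qed.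

Section UnitVector.
Variable e : plane R.
Hypothesis e1 : dot e e = 1.

Lemma dot_unit x y : dot x y = dot e x * dot e y + cross e x * cross e y.
Proof.
rewrite -[LHS]mul1r -e1.
by case: e x y => [? ?] [? ?] [? ?]; rewrite /dot /cross /=; ring.
Qed.

Lemma cross_unit x y : cross x y = dot e x * cross e y - cross e x * dot e y.
Proof.
rewrite -[LHS]mul1r -e1.
by case: e x y => [? ?] [? ?] [? ?]; rewrite /dot /cross /=; ring.
Qed.

Lemma plane_eq x y : dot e x = dot e y -> cross e x = cross e y -> x = y.
Proof.
move=> xy1 xy2; apply/eqP; rewrite -subr_eq0; apply: contraT => /dotxx_gt0.
by rewrite dot_unit dotB crossB xy1 xy2 !subrr !mul0r addr0 ltxx.
Qed.

End UnitVector.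

Lemma cos_pi4_sq : cos (pi / 4 : R) ^+ 2 = 2^-1 /\ 0 < cos (pi / 4 : R).
Proof.
have pi0 := pi_gt0 R.
have : cos ((pi / 4 : R) *+ 2) = 0.
  by rewrite -(cos_pihalf R); congr cos; rewrite -mulr_natr; field.
rewrite cos_mulr2n => h; split.
  by move: h; rewrite -mulr_natr => h; lra.
by apply: cos_gt0_pihalf; apply/andP; split; lra.
Qed.

(** For an angle of 45 degrees the sine and the cosine agree, and the cosine is
positive. Squares are compared because the sign of the cross product depends on
the orientation. *)
Lemma angle45 p q r : cross (p - q) (r - q) != 0 -> angle p q r = pi / 4 ->
  0 < dot (p - q) (r - q) /\
  dot (p - q) (r - q) ^+ 2 = cross (p - q) (r - q) ^+ 2.
Proof.
rewrite /angle; move: (p - q) (r - q) => x y c0 ac.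
have L := lagrange x y.
have x0 : 0 < dot x x.
  apply: dotxx_gt0; apply: contraNneq c0 => ->.
  by rewrite /cross /= !mul0r subrr.
have y0 : 0 < dot y y.
  apply: dotxx_gt0; apply: contraNneq c0 => ->.
  by rewrite /cross /= !mulr0 subrr.
have n0 : 0 < enorm x * enorm y by rewrite mulr_gt0 // sqrtr_gt0.
set c := dot x y / (enorm x * enorm y) in ac.
have cE : dot x y = c * (enorm x * enorm y) by rewrite /c divfK // gt_eqF.
have n2 : (enorm x * enorm y) ^+ 2 = dot x x * dot y y.
  by rewrite exprMn !enorm_sq.
have c1 : c ^+ 2 <= 1.
  have c20 := sqr_ge0 (cross x y).
  have n20 : 0 < (enorm x * enorm y) ^+ 2 by rewrite exprn_gt0.
  rewrite -(ler_pM2r n20) mul1r -exprMn -cE n2 L; lra.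
have c11 : -1 <= c <= 1.
  by rewrite -ler_norml -(@expr_le1 _ 2) // real_normK ?num_real.
have [cp cp0] := cos_pi4_sq.
have cc : c = cos (pi / 4) by rewrite -ac acosK // in_itv.
split; first by rewrite cE mulr_gt0 // cc.
have : dot x y ^+ 2 = 2^-1 * (dot x x * dot y y).
  by rewrite cE exprMn n2 cc cp.
rewrite L; lra.
Qed.

(** The distance between two parallel lines is attained along a common
perpendicular. *)
Lemma height_unit e p q r s : dot e e = 1 -> dot e (q - p) != 0 ->
  cross e (q - p) = 0 -> cross e (s - r) = 0 ->
  height p q r s = `|cross e (s - p)|.
Proof.
move=> e1 qp0 pq0 rs0.
have norm_ge z : `|cross e z| <= enorm z.
  rewrite -(ler_sqr (normr_ge0 _) (sqrtr_ge0 _)) enorm_sq real_normK ?num_real //.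
  by rewrite (dot_unit e1) -!expr2 lerDr sqr_ge0.
have level x y : line p q x -> line r s y -> cross e (x - y) = - cross e (s - p).
  move=> [t _ <-] [t' _ <-]; rewrite crossB !cross_comb.
  rewrite crossB in pq0; rewrite crossB in rs0.
  have -> : cross e q = cross e p by lra.
  have -> : cross e r = cross e s by lra.
  by rewrite crossB; ring.
apply/eqP; rewrite eq_le; apply/andP; split.
  pose t := (dot e s - dot e p) / dot e (q - p).
  pose x := (1 - t) *: p + t *: q : plane R.
  have xl : line p q x by exists t.
  have sl : line r s s by exists 1; rewrite // subrr scale0r scale1r add0r.
  have -> : `|cross e (s - p)| = enorm (x - s).
    rewrite /enorm (dot_unit e1) (level x s xl sl) dotB dot_comb.
    have -> : (1 - t) * dot e p + t * dot e q - dot e s = 0.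
      by move: qp0; rewrite /t dotB => qp0; field.
    by rewrite mul0r add0r -expr2 sqrtr_sqr normrN.
  apply: ge_inf; last by exists x => //; exists s.
  by exists 0 => _ [? _ [? _ <-]]; exact: sqrtr_ge0.
apply: lb_le_inf.
  exists (enorm (p - s)); exists p.
    by exists 0; rewrite // subr0 scale0r scale1r addr0.
  by exists s => //; exists 1; rewrite // subrr scale0r scale1r add0r.
move=> _ [x xl [y yl <-]].
by rewrite -normrN -(level _ _ xl yl).
Qed.

End TrapezoidCoordinates.

(** * Trapezoids with angles of 45 degrees as truncated triangles *)

Section TrapezoidTiles.
Variable R : realType.
Implicit Types (e u v x y z p q r s : plane R) (F : set (plane R)).

Local Notation lform e := (dot (left_normal e)).
Local Notation rform e := (dot (right_normal e)).

Lemma frame_segment e X Y x y (t : R) : frame (lform e) (rform e) X Y ->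
  X ((1 - t) *: x + t *: y) = (1 - t) * X x + t * X y.
Proof. by case; rewrite dot_comb //; ring. Qed.

Lemma trap_convex e X Y a1 a2 a3 b3 : frame (lform e) (rform e) X Y ->
  convex (trap X Y a1 a2 a3 b3).
Proof.
move=> fr x y [x1 x2 x3 x4] [y1 y2 y3 y4] z [t /andP[t0 t1] <-].
have t1' : 0 <= 1 - t by lra.
have comb c (m n : R) : c <= m -> c <= n -> c <= (1 - t) * m + t * n.
  move=> cm cn; have : 0 <= (1 - t) * (m - c) by apply: mulr_ge0; lra.
  have : 0 <= t * (n - c) by apply: mulr_ge0; lra.
  lra.
rewrite /trap /= (frame_segment _ _ _ fr) (frame_segment _ _ _ (frameC fr)).
have c1 := comb _ _ _ x1 y1; have c2 := comb _ _ _ x2 y2.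
have c3 := comb _ _ _ x3 y3.
have x4' : - b3 <= X x + Y x by lra.
have y4' : - b3 <= X y + Y y by lra.
have c4 := comb _ _ _ x4' y4'.
split=> //; lra.
Qed.

(** A point of the truncated triangle lies on a segment parallel to the bases
whose ends divide the two legs in the same ratio. *)
Lemma quadrilateral_trap e p q r s : dot e e = 1 ->
  cross e (q - p) = 0 -> 2 < dot e (q - p) ->
  dot e (s - p) = 1 -> cross e (s - p) = 1 ->
  dot e (r - q) = -1 -> cross e (r - q) = 1 ->
  quadrilateral p q r s = trap (lform e) (rform e) (lform e p) (rform e q)
    (2 * cross e p) (2 * cross e p + 2).
Proof.
move=> e1; rewrite !crossB !dotB => c1 d1 d2 c2 d3 c3.
apply/seteqP; split.
  apply: smallest_sub.
    apply/convex_setE; apply: trap_convex; exact: frame12.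
  by move=> _ [[[->|->]|->]|->]; rewrite /trap /= !lformE !rformE; split; lra.
move=> z; rewrite /trap /= !lformE !rformE => -[z1 z2 z3 z4].
move=> M [/convex_setE cM GM].
have Mp : M p by apply: GM; do 3 left.
have Mq : M q by apply: GM; do 2 left; right.
have Mr : M r by apply: GM; left; right.
have Ms : M s by apply: GM; right.
pose t := cross e z - cross e p.
pose k := dot e q - dot e p - 2 * t.
have k0 : 0 < k by rewrite /k /t; lra.
pose l := (dot e z - dot e p - t) / k.
have lk : l * k = dot e z - dot e p - t by rewrite /l divfK // gt_eqF.
have t01 : 0 <= t <= 1 by apply/andP; rewrite /t; split; lra.
have l01 : 0 <= l <= 1.
  rewrite /l divr_ge0 ?(ltW k0) //=; last by rewrite /t; lra.
  by rewrite ler_pdivrMr // mul1r /k /t; lra.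
pose x := (1 - t) *: p + t *: s : plane R.
pose y := (1 - t) *: q + t *: r : plane R.
have Mx : M x by apply: (cM _ _ Mp Ms); exists t.
have My : M y by apply: (cM _ _ Mq Mr); exists t.
have -> : z = (1 - l) *: x + l *: y; last by apply: (cM _ _ Mx My); exists l.
have dx : dot e x = dot e p + t.
  by rewrite dot_comb (_ : dot e s = dot e p + 1); [ring|lra].
have dy : dot e y = dot e q - t.
  by rewrite dot_comb (_ : dot e r = dot e q - 1); [ring|lra].
have cx : cross e x = cross e p + t.
  by rewrite cross_comb (_ : cross e s = cross e p + 1); [ring|lra].
have cy : cross e y = cross e p + t.
  rewrite cross_comb (_ : cross e r = cross e p + 1); last by lra.
  by rewrite (_ : cross e q = cross e p); [ring|lra].
apply: (plane_eq e1).
  rewrite dot_comb dx dy.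
  have -> : (1 - l) * (dot e p + t) + l * (dot e q - t) =
    dot e p + t + l * k by rewrite /k; ring.
  by rewrite lk; ring.
by rewrite cross_comb cx cy /t; ring.
Qed.

(** Reversing e exchanges the frames in pairs. *)
Lemma tile_opp e a F : tile (- e) a F -> tile e a F.
Proof.
have lE : lform (- e) = (fun z => - lform e z).
  by apply/funext => -[z1 z2]; rewrite /dot /=; ring.
have rE : rform (- e) = (fun z => - rform e z).
  by apply/funext => -[z1 z2]; rewrite /dot /=; ring.
move=> [X [Y [a1 [a2 [a3 [b3 [fr ab ba ra FE]]]]]]].
exists X, Y, a1, a2, a3, b3; split => //.
have NN (f : plane R -> R) : (fun z => - - f z) = f.
  by apply/funext => z; rewrite opprK.
by rewrite lE rE in fr; case: fr; rewrite ?NN; constructor.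
Qed.

(** With the larger base pq below, height 1 and the two angles give
s = p + (1, 1) and r = q + (- 1, 1) in the coordinates of e. *)
Lemma trapezoid45_tile_up e m p q r s : dot e e = 1 ->
  trapezoid p q r s -> parallel (q - p) e -> 0 < cross e (s - p) ->
  angle s p q = pi / 4 -> angle p q r = pi / 4 ->
  height p q r s = 1 -> midline p q r s = m ->
  tile e m (quadrilateral p q r s).
Proof.
move=> e1 [[ccw1 ccw2 _ _] par _] pe sp0 ang1 ang2 h1 mid.
have qp : cross e (q - p) = 0.
  by move: pe; rewrite /parallel !crossE; case: e {e1 sp0} (q - p) => [? ?] [? ?];
    rewrite /cross /dot /=; lra.
rewrite (cross_unit e1 (q - p)) qp mul0r subr0 in ccw1.
rewrite (cross_unit e1 (r - q)) in ccw2.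
rewrite /parallel (cross_unit e1 (q - p)) qp mul0r subr0 in par.
have qp0 : dot e (q - p) != 0.
  by apply: contraTneq ccw1 => ->; rewrite mul0r ltxx.
have sr : cross e (s - r) = 0.
  by move/eqP: par; rewrite mulf_eq0 (negPf qp0) => /eqP.
have := height_unit e1 qp0 qp sr; rewrite h1 gtr0_norm // => sp1.
have rq1 : cross e (r - q) = 1 by move: sr qp; rewrite !crossB in sp1 *; lra.
rewrite sr rq1 mulr0 sub0r mul1r in ccw2.
rewrite rq1 mulr1 in ccw1.
have c1 : cross (s - p) (q - p) = - dot e (q - p).
  by rewrite (cross_unit e1 (s - p)) qp -sp1; ring.
have pq : cross e (p - q) = 0 by move: qp; rewrite !crossB; lra.
have dpq : dot e (p - q) = - dot e (q - p) by rewrite !dotB; ring.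
have c2 : cross (p - q) (r - q) = - dot e (q - p).
  by rewrite (cross_unit e1 (p - q)) pq rq1 dpq; ring.
have c1' : cross (s - p) (q - p) != 0 by rewrite c1 oppr_eq0.
have c2' : cross (p - q) (r - q) != 0 by rewrite c2 oppr_eq0.
have sq (x y : R) : 0 < x -> 0 < x * y -> (x * y) ^+ 2 = (- x) ^+ 2 -> y = 1.
  move=> x0 xy0; rewrite sqrrN => /eqP.
  rewrite eqrXn2 // ?ltW // => /eqP xy; apply: (mulfI (lt0r_neq0 x0)); lra.
have [d1 e11] := angle45 c1' ang1; have [d2 e22] := angle45 c2' ang2.
have ds : dot e (s - p) = 1.
  apply: (sq (dot e (q - p))) => //.
    by move: d1; rewrite (dot_unit e1 (s - p)) qp mulr0 addr0 mulrC.
  by rewrite -c1 -e11 (dot_unit e1 (s - p)) qp mulr0 addr0 mulrC.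
have dr : dot e (r - q) = - 1.
  suff : - dot e (r - q) = 1 by lra.
  apply: (sq (dot e (q - p))) => //.
    by move: d2; rewrite (dot_unit e1 (p - q)) pq mul0r addr0 dpq mulrN mulNr.
  by rewrite -c2 -e22 (dot_unit e1 (p - q)) pq mul0r addr0 dpq mulrN mulNr.
have srE : dot e (s - r) = 2 - dot e (q - p).
  by move: ds dr; rewrite !dotB; lra.
have q2 : 2 < dot e (q - p) by lra.
rewrite (quadrilateral_trap e1 qp q2 ds (esym sp1) dr rq1).
have nq : enorm (q - p) = dot e (q - p).
  rewrite /enorm (dot_unit e1) qp mul0r addr0 -expr2 sqrtr_sqr gtr0_norm //.
have nr : enorm (s - r) = dot e (q - p) - 2.
  rewrite /enorm (dot_unit e1) sr mul0r addr0 -expr2 sqrtr_sqr srE ltr0_norm; lra.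
have mE : m = dot e (q - p) - 1 by rewrite -mid /midline nq nr; lra.
exists (lform e), (rform e); do 4 eexists; split; [exact: frame12| | | |reflexivity].
- by lra.
- by rewrite lformE rformE; move: q2 qp; rewrite dotB crossB; lra.
rewrite mE /trap_ratio lformE rformE.
have -> : 2 * cross e p + 2 - 2 * cross e p = 2 by ring.
have -> : cross e q = cross e p by move: qp; rewrite crossB; lra.
by rewrite dotB; field.
Qed.

Lemma trapezoid45_tile e m F : dot e e = 1 -> trapezoid45 e m F -> tile e m F.
Proof.
move=> e1 [p [q [r [s [[tr -> pe] [_ a1 a2 h1 mid]]]]]].
have [sp0|sp0|sp0] := ltgtP 0 (cross e (s - p)).
- exact: trapezoid45_tile_up.
- have Nc x : cross (- e) x = - cross e x.
    by case: e {e1 pe sp0} x => [? ?] [? ?]; rewrite /cross /=; ring.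
  apply: tile_opp; apply: trapezoid45_tile_up => //.
  + by rewrite -e1; case: e {e1 pe sp0 Nc} => [? ?]; rewrite /dot /=; ring.
  + move: pe; rewrite /parallel.
    by case: e {e1 sp0 Nc} (q - p) => [? ?] [? ?]; rewrite /cross /=; lra.
  + by rewrite Nc oppr_gt0.
- case: tr => -[c1 c2 c3 c4] _ _.
  have qp : cross e (q - p) = 0.
    by move: pe; rewrite /parallel; case: e {e1 sp0} (q - p) => [? ?] [? ?];
      rewrite /cross /=; lra.
  move: c4; rewrite (cross_unit e1 (p - s)) qp mulr0 sub0r -opprB.
  have -> : cross e (- (s - p)) = - cross e (s - p).
    by rewrite opprB !crossB; ring.
  by rewrite -sp0 oppr0 mul0r oppr0 ltxx.
Qed.

(** A negative homothety ratio turns the trapezoid upside down, which amounts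
to changing the signs of the frame. *)
Lemma homothetic_tile e a A t : tile e a A -> homothetic A t -> tile e a t.
Proof.
move=> [X [Y [a1 [a2 [a3 [b3 [fr ab ba ra ->]]]]]]] [l [w [l0 ->]]].
have aff X' Y' : frame (lform e) (rform e) X' Y' ->
    forall z, X' (l *: z + w) = l * X' z + X' w.
  by case=> z; rewrite -{1}[w]scale1r dot_comb; ring.
have fr' := frameC fr.
have XE := aff _ _ fr; have YE := aff _ _ fr'.
have inv z : z = l *: (l^-1 *: (z - w)) + w.
  by rewrite scalerA divff // scale1r subrK.
have XI z : X (l^-1 *: (z - w)) = l^-1 * (X z - X w).
  by rewrite {2}(inv z) XE addrK mulKf.
have YI z : Y (l^-1 *: (z - w)) = l^-1 * (Y z - Y w).
  by rewrite {2}(inv z) YE addrK mulKf.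
have ratio : trap_ratio (`|l| * a1 + Num.sg l * X w) (`|l| * a2 + Num.sg l * Y w)
   (`|l| * a3 - Num.sg l * (X w + Y w)) (`|l| * b3 - Num.sg l * (X w + Y w)) = a.
  rewrite -ra /trap_ratio; have : `|l| != 0 by rewrite normr_eq0.
  move: `|l| (Num.sg l) => n g n0; have ba0 : b3 - a3 != 0 by lra.
  have -> : n * b3 - g * (X w + Y w) - (n * a3 - g * (X w + Y w)) =
    n * (b3 - a3) by ring.
  by field; rewrite n0 ba0.
have n0 : 0 < `|l| by rewrite normr_gt0.
have lt1 : `|l| * a3 < `|l| * b3 by rewrite ltr_pM2l.
have lt2 : `|l| * b3 < `|l| * (- a1 - a2) by rewrite ltr_pM2l.
pose X' : plane R -> R := if 0 < l then X else (fun z => - X z).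
pose Y' : plane R -> R := if 0 < l then Y else (fun z => - Y z).
exists X', Y'; do 4 eexists; split; [| | |exact: ratio|].
- by rewrite /X' /Y'; case: ifP => // _; exact: frameN.
- by lra.
- by lra.
have XE' z : X' (l *: z + w) = `|l| * X z + Num.sg l * X w.
  rewrite /X'; case: (ltgtP l 0) l0 => // l0 _; rewrite XE.
    by rewrite ltr0_norm // ltr0_sg //; ring.
  by rewrite gtr0_norm // gtr0_sg //; ring.
have YE' z : Y' (l *: z + w) = `|l| * Y z + Num.sg l * Y w.
  rewrite /Y'; case: (ltgtP l 0) l0 => // l0 _; rewrite YE.
    by rewrite ltr0_norm // ltr0_sg //; ring.
  by rewrite gtr0_norm // gtr0_sg //; ring.
have sub z : trap X Y a1 a2 a3 b3 z <->
  trap X' Y' (`|l| * a1 + Num.sg l * X w) (`|l| * a2 + Num.sg l * Y w)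
   (`|l| * a3 - Num.sg l * (X w + Y w)) (`|l| * b3 - Num.sg l * (X w + Y w))
   (l *: z + w).
  rewrite /trap /= XE' YE'.
  rewrite -(ler_pM2l n0 a1) -(ler_pM2l n0 a2) -(ler_pM2l n0 a3) -(ler_pM2l n0 _ b3).
  by split=> -[? ? ? ?]; split; lra.
apply/seteqP; split => [_ [z /sub zT <-] //|z].
by rewrite [z]inv => /sub ?; exists (l^-1 *: (z - w)); rewrite // -inv.
Qed.

End TrapezoidTiles.

(** The vector e enters only through its direction, so it may be taken of
length 1. *)
Lemma trapezoid45_direction (R : realType) (e : plane R) : e != 0 ->
  exists2 u : plane R, dot u u = 1 &
    forall m F, trapezoid45 e m F -> trapezoid45 u m F.
Proof.
move=> e0; have n0 : 0 < enorm e by rewrite sqrtr_gt0 dotxx_gt0.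
have uE : (enorm e)^-1 *: e = ((enorm e)^-1 * e.1, (enorm e)^-1 * e.2) by [].
exists ((enorm e)^-1 *: e).
  have : (enorm e)^-1 ^+ 2 * dot e e = 1.
    by rewrite -enorm_sq -exprMn mulVf ?expr1n // gt_eqF.
  by rewrite uE => <-; rewrite /dot /=; ring.
move=> m F [p [q [r [s [[tr FE pe] H]]]]]; exists p, q, r, s; split=> //.
split=> //; move: pe; rewrite /parallel uE => pe.
have -> : cross (q - p) ((enorm e)^-1 * e.1, (enorm e)^-1 * e.2) =
  (enorm e)^-1 * cross (q - p) e by rewrite /cross /=; ring.
by rewrite pe mulr0.
Qed.

Theorem mainTheorem3 (R : realType) (d : rat) (a b : R) (e : plane R)
    (A B : set (plane R))
    (d_gt0 : 0 < d)
    (sqrtd_irrational : forall q : rat, Num.sqrt (ratr d) <> ratr q :> R)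
    (e_neq0 : e != 0)
    (A_trapezoid : trapezoid45 e a A)
    (B_trapezoid : trapezoid45 e b B)
    (a_Qsqrt : Qsqrt d a)
    (b_Qsqrt : Qsqrt d b)
    (a_conj : 1 < qconj d a < a)
    (B_tiled : exists T : set (set (plane R)),
      trivial_tiling B T /\ (forall t, T t -> homothetic A t)) :
  [/\ 1 < qconj d b < b,
      qconj d b / b >= qconj d a / a &
      ln (G b) / ln (qconj d (G b)) >= ln (G a) / ln (qconj d (G a))].
Proof.
have qc (x x' : R) : conjugates d x x' -> qconj d x = x'.
  exact: (conjugates_qconj sqrtd_irrational).
have qG (x x' : R) : 0 < x -> conjugates d x x' -> qconj d (G x) = G x'.
  move=> x0 cx; apply: qc; apply: (conjugates_G d_gt0 sqrtd_irrational) => //.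
  by rewrite gt_eqF // addr_gt0.
have [a' ca] : exists a' : R, conjugates d a a'.
  by case: a_Qsqrt => u [v ->]; eexists; exists u, v; split.
rewrite (qc _ _ ca) in a_conj *; case/andP: a_conj => a'1 a'a.
have a0 : 0 < a by lra.
have fa' := acoth2_gt0 a'1.
have a1 : 1 < a by lra.
have fa := acoth2_gt0 a1.
pose rho := a' / a; pose kappa := acoth2 a / acoth2 a'.
have rho0 : 0 < rho by rewrite divr_gt0 //; lra.
have rho1 : rho < 1 by rewrite ltr_pdivrMr // mul1r.
have rhoa : rho * a = a' by rewrite divfK // gt_eqF.
have kappa0 : 0 < kappa by rewrite divr_gt0.
have kappa_rho : kappa <= rho.
  rewrite ler_pdivrMr // -rhoa; apply: acoth2_scale_le; last by rewrite rhoa.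
  by rewrite rho0 ltW.
have Ia : trap_inv d rho kappa a.
  by exists a'; split=> //; rewrite rhoa lexx divfK // gt_eqF.
have [u u1 uP] := trapezoid45_direction e_neq0.
have u0 : u != 0.
  by apply: contra_eq_neq u1 => ->; rewrite /dot /= !mul0r addr0 eq_sym oner_eq0.
have tA := trapezoid45_tile u1 (uP _ _ A_trapezoid).
have tB := trapezoid45_tile u1 (uP _ _ B_trapezoid).
have [T [BT TA]] := B_tiled.
have tT t : T t -> tile u a t by move=> /TA; exact: homothetic_tile.
have [X [Y [b1 [b2 [b3 [c3 [fr bc _ bE BE]]]]]]] := tB.
have cB : convex B by rewrite BE; exact: trap_convex fr.
have gB := trivial_tiling_guillotine u0 BT tT cB.
have : trap_inv d rho kappa (trap_ratio b1 b2 b3 c3).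
  apply: (guillotine_trap_ratio (normals_surj u0) Ia _ _ _ _ _ gB fr BE bc
    (parP := par_inv d rho)).
  - by move=> x y; exact: par_invD.
  - by move=> x y; exact: par_inv_harmonic.
  - by move=> x; exact: trap_inv_par.
  - by move=> x y; exact: trap_invD.
  - by move=> x y; exact: trap_inv_coth.
rewrite bE => -[b' [cb b'1 b'b [rb kb]]].
have fb' := acoth2_gt0 b'1.
have bb : 1 < b by lra.
rewrite (qc _ _ cb); split.
- by rewrite b'1.
- by rewrite ler_pdivlMr //; lra.
rewrite (qG _ _ _ cb) ?(qG _ _ _ ca); [|lra|lra].
rewrite !lnGE // !invrN !mulrNN.
by rewrite ler_pdivlMr.
Qed.
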